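(* Let $Q_0$ be a cube in $\mathbb{R}^n$, let $1<p\le q<\infty$, and let $(v,w)$ be a pair of weights in $Q_0$ such that $w\in A_\infty^d(Q_0)$ with constants $C_w,\delta_w$ and $\sigma=v^{-1/(p-1)}\in A_\infty^d(Q_0)$ with constants $C_\sigma,\delta_\sigma$. Suppose that there exists a constant $K>0$ such that $$\left(\frac{1}{|Q|^{1-1/n}}\right)^p w(Q)^{p/q}\,\sigma(Q)^{p-1}\le K$$ for all dyadic cubes $Q\in\mathcal{D}(Q_0)$. Then there is a constant $C=C(n,p,q,K,C_w,C_\sigma,\delta_w,\delta_\sigma)>0$ such that for every $u\in\mathrm{Lip}(Q_0)$, $$\left(\int_{Q_0}|u(x)-u_{Q_0}|^q\,w(x)\,dx\right)^{1/q}\le C\left(\int_{Q_0}|\nabla u(x)|^p\,v(x)\,dx\right)^{1/p}.$$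
   Context: A cube in $\mathbb{R}^n$ is a half-open set $[a_1,b_1)\times\cdots\times[a_n,b_n)$ with $b_1-a_1=\dots=b_n-a_n>0$. For a cube $Q_0$, $\mathcal{D}(Q_0)$ is the collection of dyadic subcubes of $Q_0$: $Q_0$ itself together with all cubes obtained by repeatedly bisecting each edge (each cube has $2^n$ dyadic children). A weight in $Q_0$ is a locally integrable function $w$ on $Q_0$ with $w(x)>0$ for almost every $x\in Q_0$; for measurable $E$, $w(E)=\int_E w(x)\,dx$. A weight $w$ in $Q_0$ belongs to $A_\infty^d(Q_0)$ with constants $C_w,\delta_w\in(0,\infty)$ if for all $Q\in\mathcal{D}(Q_0)$ and all measurable $E\subset Q$, $$\frac{w(E)}{w(Q)}\le C_w\left(\frac{|E|}{|Q|}\right)^{\delta_w}$$ (in particular $0<w(Q)<\infty$ is implicit). $f_E=\frac{1}{|E|}\int_E f(x)\,dx$ denotes the (unweighted) integral average. $\mathrm{Lip}(Q_0)$ is the set of Lipschitz continuous real-valued functions on $Q_0$; $\nabla u$ is defined almost everywhere. *)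

(* Defs.v *)
From HB Require Import structures.
From mathcomp Require Import all_boot all_order all_algebra.
From mathcomp Require Import all_classical all_reals all_analysis.

Set Implicit Arguments.
Unset Strict Implicit.
Unset Printing Implicit Defensive.

Import Order.TTheory GRing.Theory Num.Theory.
Import numFieldNormedType.Exports.

Local Open Scope classical_set_scope.
Local Open Scope ring_scope.

Definition measure_rV_display : measure_display.
Proof. exact. Qed.

Section measurable_rV.
Variables (R : realType) (n : nat).

Let coords : 'I_n -> 'rV[R]_n -> R := fun i x => x ord0 i.

Let rV_set0 : g_sigma_preimage coords set0.
Proof. exact: sigma_algebra0. Qed.

Let rV_setC A : g_sigma_preimage coords A -> g_sigma_preimage coords (~` A).
Proof. exact: sigma_algebraC. Qed.

Let rV_bigcup (F : (set 'rV[R]_n)^nat) :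
  (forall i, g_sigma_preimage coords (F i)) ->
  g_sigma_preimage coords (\bigcup_i (F i)).
Proof. exact: sigma_algebra_bigcup. Qed.

HB.instance Definition _ := @isMeasurable.Build measure_rV_display
  'rV[R]_n (g_sigma_preimage coords) rV_set0 rV_setC rV_bigcup.
End measurable_rV.

Lemma measurable_coord (R : realType) (n : nat) (i : 'I_n) :
  measurable_fun [set: 'rV[R]_n] (fun x : 'rV[R]_n => x ord0 i).
Proof.
move=> _ Y mY; rewrite setTI; apply: sub_sigma_algebra => /=.
rewrite -bigcup_seq/=; exists i => /=; first by rewrite mem_index_enum.
by exists Y => //; rewrite setTI.
Qed.

Lemma measurable_fun_rV d (T : measurableType d) (R : realType) (n : nat)
    (f : T -> 'rV[R]_n) :
  (forall i, measurable_fun [set: T] (fun t => f t ord0 i)) ->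
  measurable_fun [set: T] f.
Proof.
move=> mf _ Y mY; rewrite setTI; move: Y mY.
suff H : g_sigma_preimage (fun (i : 'I_n) (x : 'rV[R]_n) => x ord0 i) `<=`
    [set Y | measurable (f @^-1` Y)] by move=> Y /H.
apply: smallest_sub.
  split => [|A /= mA|F mF] /=.
  - by rewrite preimage_set0.
  - by rewrite setTD -preimage_setC; exact: measurableC.
  - by rewrite preimage_bigcup; apply: bigcupT_measurable => k; exact: mF.
move=> A; rewrite -bigcup_seq/= => -[i _ [B mB <-]] /=.
by rewrite setTI -(setTI (_ @^-1` _)); exact: mf.
Qed.

Section lebesgue_step.
Local Open Scope ereal_scope.
Variables (R : realType) (n : nat).

Definition cons_rV (p : measurableTypeR R * 'rV[R]_n) : 'rV[R]_n.+1 :=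
  row_mx (p.1 : R)%:M p.2.

Lemma measurable_cons_rV : measurable_fun setT cons_rV.
Proof.
apply: measurable_fun_rV => i; rewrite /cons_rV.
case: (@split_ordP 1 n i) => j ->.
- under eq_fun do rewrite (row_mxEl ((_ : R)%:M : 'rV_1)) (ord1 j) mxE eqxx mulr1n.
  exact: measurable_fst.
- under eq_fun do rewrite (row_mxEr ((_ : R)%:M : 'rV_1)).
  by apply: (measurableT_comp (measurable_coord j)); exact: measurable_snd.
Qed.

Definition uncons_rV (x : 'rV[R]_n.+1) : measurableTypeR R * 'rV[R]_n :=
  (x ord0 ord0, \row_j x ord0 (lift ord0 j)).

Lemma measurable_uncons_rV : measurable_fun setT uncons_rV.
Proof.
apply/measurable_fun_pair; first exact: measurable_coord.
apply: measurable_fun_rV => i; under eq_fun do rewrite mxE.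
exact: measurable_coord.
Qed.

Lemma cons_rVK : cancel cons_rV uncons_rV.
Proof.
case=> x y; rewrite /uncons_rV /cons_rV /=; congr pair.
  have -> : (ord0 : 'I_n.+1) = lshift n (ord0 : 'I_1) by apply/val_inj.
  by rewrite (row_mxEl ((x : R)%:M : 'rV_1)) mxE eqxx mulr1n.
apply/rowP => j; rewrite mxE.
have -> : lift ord0 j = rshift 1 j by apply/val_inj.
by rewrite (row_mxEr ((x : R)%:M : 'rV_1)).
Qed.

Variable m : {sigma_finite_measure set 'rV[R]_n -> \bar R}.

Definition lebesgue_step : set 'rV[R]_n.+1 -> \bar R :=
  pushforward (lebesgue_measure \x m) cons_rV.

Let step_measure : {measure set 'rV[R]_n.+1 -> \bar R} :=
  measure_function_pushforward__canonical__measure_function_Measure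
    (lebesgue_measure \x m) measurable_cons_rV.

HB.instance Definition _ := isMeasure.Build _ _ _ lebesgue_step
  (measure0 step_measure) (measure_ge0 step_measure)
  (@measure_semi_sigma_additive _ _ _ step_measure).

Let sigma_finite_lebesgue_step : sigma_finite setT lebesgue_step.
Proof.
have /sigma_finiteP[F [FT ndF Foo]] := sigma_finiteT (@lebesgue_measure R).
have /sigma_finiteP[G [GT ndG Goo]] := sigma_finiteT m.
exists (fun k => uncons_rV @^-1` (F k `*` G k)).
  rewrite -preimage_bigcup -(preimage_setT uncons_rV); congr (_ @^-1` _).
  apply/seteqP; split => // -[x y] _.
  have : setT x by []. rewrite FT => -[i _ Fix].
  have : setT y by []. rewrite GT => -[j _ Gjy].
  exists (maxn i j) => //; split => /=.
  - by move: x Fix; exact/subsetPset/ndF/leq_maxl.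
  - by move: y Gjy; exact/subsetPset/ndG/leq_maxr.
move=> k; have [mF Fk] := Foo k; have [mG Gk] := Goo k; split.
  by rewrite -(setTI (_ @^-1` _)); apply: measurable_uncons_rV => //; exact: measurableX.
rewrite /lebesgue_step /pushforward -comp_preimage.
rewrite (_ : _ \o _ = id); last by apply/funext => p /=; rewrite cons_rVK.
by rewrite preimage_id product_measure1E// lte_mul_pinfty// ge0_fin_numE.
Qed.

HB.instance Definition _ := Measure_isSigmaFinite.Build _ _ _ lebesgue_step
  sigma_finite_lebesgue_step.
End lebesgue_step.

Fixpoint borel_lebesgue (R : realType) (n : nat) :
    {sigma_finite_measure set 'rV[R]_n -> \bar R} :=
  if n is k.+1 then lebesgue_step (borel_lebesgue R k)
  else dirac (0 : 'rV[R]_0).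

(* Lebesgue-measurable sets and Lebesgue measure of R^n: the completion of the
   n-fold product measure, as `completed_lebesgue_measure` is for the line. *)
Notation lebesgue_type R n := (caratheodory_type (mu_ext (borel_lebesgue R n))).

Definition lebesgue_rV (R : realType) (n : nat) :
    {measure set (lebesgue_type R n) -> \bar R} :=
  @completed_measure_extension _ _ _ (borel_lebesgue R n).

Section weights.
Variables (R : realType) (n : nat).
Implicit Types (Q E : set 'rV[R]_n) (w f u : 'rV[R]_n -> R).
Local Notation mu := (lebesgue_rV R n).

Definition cube (a : 'rV[R]_n) (l : R) : set 'rV[R]_n :=
  [set x | forall i, a ord0 i <= x ord0 i < a ord0 i + l].

Definition is_cube Q := exists a l, 0 < l /\ Q = cube a l.

Inductive dyadic (Q0 : set 'rV[R]_n) : set 'rV[R]_n -> Prop :=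
| dyadic_root : dyadic Q0 Q0
| dyadic_child (a : 'rV[R]_n) (l : R) (upper : 'I_n -> bool) :
    0 < l -> dyadic Q0 (cube a l) ->
    dyadic Q0 (cube (\row_i (a ord0 i + (upper i)%:R * (l / 2))) (l / 2)).

(* Only the values of functions on Q0 matter. *)
Definition weight (Q0 : set 'rV[R]_n) w :=
  [/\ measurable_fun (Q0 : set (lebesgue_type R n)) (w : lebesgue_type R n -> R),
      forall K : set 'rV[R]_n, K `<=` Q0 -> compact K ->
        (\int[mu]_(x in K) `|w x|%:E < +oo)%E
    & {ae mu, forall x, Q0 x -> 0 < w x}].

Definition wmeas w E : \bar R := (\int[mu]_(x in E) (w x)%:E)%E.

Definition dyadic_Ainfty (Q0 : set 'rV[R]_n) w (C delta : R) :=
  [/\ weight Q0 w, 0 < C, 0 < delta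
    & forall Q, dyadic Q0 Q ->
        (0 < wmeas w Q < +oo)%E /\
        forall E, measurable (E : set (lebesgue_type R n)) -> E `<=` Q ->
          (wmeas w E / wmeas w Q <= C%:E * (mu E / mu Q) `^ delta)%E].

Definition average f E : R := (fine (mu E))^-1 * \int[mu]_(x in E) f x.

(* Each coordinate has the library's arbitrary value where the partial
   derivative fails to exist; for u Lipschitz on a cube this, as well as the
   dependence on u outside the cube, only concerns a null set of the cube. *)
Definition gradient u (x : 'rV[R]_n) : 'rV[R]_n :=
  \row_i 'D_(delta_mx ord0 i) u x.

(* The norm `|x| of 'rV[R]_n is the sup norm, hence the Euclidean norm here. *)
Definition enorm (x : 'rV[R]_n) : R := Num.sqrt (\sum_i x ord0 i ^+ 2).

End weights.

(* Main.v *)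
Require Import Defs.
From HB Require Import structures.
From mathcomp Require Import all_boot all_order all_algebra all_fingroup.
From mathcomp Require Import all_classical all_reals all_analysis.
From mathcomp Require Import measurable_realfun ring lra.
Import Order.TTheory GRing.Theory Num.Theory.
Import numFieldNormedType.Exports.

(** Write [g] for [|grad u|] and [sigma] for the dual weight.  Telescoping the
averages of [u] along the dyadic cubes containing [x], and using the
(1,1)-Poincare inequality on each cube, bounds [|u x - u_Q0|] by the dyadic
Riesz potential, the sum of [l(Q) g_Q] over the dyadic cubes [Q] containing
[x].  Since [l(Q)] decays geometrically, it suffices to sum over the principal
cubes of [g], where the average of [g] first exceeds [A] times that of the
previous principal cube.  By the [A_infty] conditions and for [A] large, the
principal cubes are sparse for both [w] and [sigma].  Sparseness for [w] gives
[||sum a_S 1_S||_{L^q(w)}^q <= C sum a_S^q w(S)], the testing condition bounds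
[a_S^q w(S)] by a multiple of [(sigma(S) <g/sigma>_S^p)^(q/p)], with averages
taken for [sigma], and, as [q >= p], the dyadic Carleson embedding for [sigma]
concludes.  As [u] is Lipschitz, one may stop at generation [k] and let [k]
tend to infinity, so that only finite trees of cubes occur.

The Poincare inequality compares adjacent subcubes through the function
[s |-> int_E u(x + s e_i) dx], which is differentiable by dominated convergence
because partial derivatives of Lipschitz functions exist almost everywhere; the
latter follows by Fubini from the one-dimensional case, a consequence of the
Radon-Nikodym and Lebesgue differentiation theorems. *)

Set Implicit Arguments.
Unset Strict Implicit.
Unset Printing Implicit Defensive.

Local Open Scope classical_set_scope.
Local Open Scope ring_scope.

(** * Power inequalities *)

(** The common currency is the perspective x^p y^(1-p). As sigma^(1-p) = v, its value at (|grad u|,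
    sigma) is the integrand |grad u|^p v, and its value at the integrals of g and sigma over Q is
    sigma(Q) <g/sigma>_Q^p. It is convex and homogeneous, with tangent planes linear in both
    arguments, so it is subadditive over children and obeys Jensen's inequality; the tree argument
    then needs neither a maximal function nor duality. Two smallness conditions fix A. Each stop
    costs a factor 2^q in (x + y)^q <= 2^q (x^q + y^q), so the w-mass of the next stopping cubes
    must be at most 1/(2 2^q) of that of their parent; the Carleson step asks for 1/2 with sigma.
    Outside Q_0 nothing is known of u, and its gradient is arbitrary on the faces. Hence u is
    replaced by a Lipschitz function on the whole space whose gradient agrees with that of u almost
    everywhere in the cube. Fubini and translations are used for the Borel product measure, whereas
    the weights are measurable only for its completion; the two are joined by pushforward along the
    identity. *)

Section powR_inequalities.
Variable R : realType.
Implicit Types (p q r x y c : R).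

Lemma ler_powR2r r x y : 0 <= r -> 0 <= x -> x <= y -> x `^ r <= y `^ r.
Proof.
move=> r0 x0 xy; apply: ge0_ler_powR => //; rewrite nnegrE //.
exact: le_trans xy.
Qed.

Lemma powRD_le r x y : 0 <= r -> 0 <= x -> 0 <= y ->
  (x + y) `^ r <= 2 `^ r * (x `^ r + y `^ r).
Proof.
move=> r0; wlog xy : x y / x <= y.
  move=> H x0 y0; have [xy|/ltW yx] := leP x y; first exact: H.
  by rewrite addrC [X in _ * X]addrC; exact: H.
move=> x0 y0; apply: (@le_trans _ _ ((2 * y) `^ r)).
  by apply: ler_powR2r => //; lra.
by rewrite powRM // ler_wpM2l ?powR_ge0 // lerDr powR_ge0.
Qed.

(** Young's inequality for [x] and c^(p-1) with the conjugate exponents p and p/(p-1), multiplied by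
    p. It is convexity of the p-th power, seen from its tangent at [c]. *)
Lemma powR_gt_tangent p c x : 1 < p -> 0 <= c -> 0 <= x ->
  p * (c `^ (p - 1) * x) - (p - 1) * c `^ p <= x `^ p.
Proof.
move=> p1 c0 x0; have p0 : 0 < p by lra.
have p10 : 0 < p - 1 by lra.
have p'0 : 0 < p / (p - 1) by rewrite divr_gt0.
have := @conjugate_powR R x (c `^ (p - 1)) p (p / (p - 1)) x0 (powR_ge0 _ _)
  p0 p'0.
have -> : p^-1 + (p / (p - 1))^-1 = 1 by field; rewrite !gt_eqF.
move=> /(_ erefl).
rewrite -powRrM (_ : (p - 1) * (p / (p - 1)) = p); last by field; rewrite gt_eqF.
move=> /(ler_wpM2l (ltW p0)).
have -> : p * (x `^ p / p + c `^ p / (p / (p - 1))) = x `^ p + (p - 1) * c `^ p.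
  by field; rewrite !gt_eqF.
by rewrite lerBlDr (mulrC (c `^ _)).
Qed.

(** The perspective of t^p in the sense of convex analysis, equal to (x/y)^p y when y > 0. *)
Definition perspective p x y := x `^ p * y `^ (1 - p).

Lemma perspective_ge0 p x y : 0 <= perspective p x y.
Proof. by rewrite mulr_ge0 ?powR_ge0. Qed.

Lemma perspectiveE p x y : 1 < p -> 0 <= x -> 0 < y ->
  perspective p x y = (x / y) `^ p * y.
Proof.
move=> p1 x0 y0; rewrite /perspective powRM ?invr_ge0 ?(ltW y0) //.
rewrite -(powR_inv1 (ltW y0)) -powRrM mulN1r -mulrA; congr (_ * _).
by rewrite addrC powRD ?powRr1 ?(ltW y0) // (gt_eqF y0) implybT.
Qed.

(** The tangent plane along the ray x = c y. Being linear in both arguments, it can be summed or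
    integrated with [c] fixed, and it is exact for c = x/y. *)
Lemma perspective_tangent p c x y : 1 < p -> 0 <= c -> 0 <= x -> 0 < y ->
  p * (c `^ (p - 1) * x) - (p - 1) * (c `^ p * y) <= perspective p x y.
Proof.
move=> p1 c0 x0 y0; rewrite perspectiveE //.
have := @powR_gt_tangent p c (x / y) p1 c0 (divr_ge0 x0 (ltW y0)).
move=> /(ler_wpM2r (ltW y0)); apply: le_trans; rewrite le_eqVlt; apply/orP; left.
by apply/eqP; field; rewrite gt_eqF.
Qed.

Lemma perspective_tangent_eq p x y : 1 < p -> 0 <= x -> 0 < y ->
  p * ((x / y) `^ (p - 1) * x) - (p - 1) * ((x / y) `^ p * y) =
  perspective p x y.
Proof.
move=> p1 x0 y0; rewrite perspectiveE //.
rewrite -(@mulr_powRB1 _ (x / y) p) ?divr_ge0 ?(ltW y0) //; last by lra.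
by field; rewrite gt_eqF.
Qed.

(** Sum the tangent inequalities of the terms, all taken at the slope of the totals, where the
    tangent is exact. *)
Lemma perspective_sum p (I : finType) (x y : I -> R) : 1 < p ->
  (forall i, 0 <= x i) -> (forall i, 0 < y i) -> 0 < \sum_i y i ->
  perspective p (\sum_i x i) (\sum_i y i) <= \sum_i perspective p (x i) (y i).
Proof.
move=> p1 x0 y0 sy; have sx : 0 <= \sum_i x i by rewrite sumr_ge0.
rewrite -perspective_tangent_eq // mulr_sumr mulr_sumr mulr_sumr mulr_sumr -sumrB.
apply: ler_sum => i _; apply: perspective_tangent => //.
by rewrite divr_ge0 // ltW.
Qed.

(** Each term is x_i times x_i^(r-1), and x_i is at most the whole sum. *)
Lemma powR_sum r (I : finType) (x : I -> R) : 1 <= r ->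
  (forall i, 0 <= x i) -> \sum_i x i `^ r <= (\sum_i x i) `^ r.
Proof.
move=> r1 x0; have sx : 0 <= \sum_i x i by rewrite sumr_ge0.
have r0 : 0 < r by lra.
rewrite -(mulr_powRB1 sx) // mulr_suml; apply: ler_sum => i _.
rewrite -(mulr_powRB1 (x0 i)) // ler_wpM2l //; apply: ler_powR2r => //.
  by rewrite subr_ge0.
by rewrite (bigD1 i) //= lerDl sumr_ge0.
Qed.

Lemma powR_opp_antimono r x y : 0 <= r -> 0 < x -> x <= y ->
  y `^ (- r) <= x `^ (- r).
Proof.
move=> r0 x0 xy; rewrite !powRN lef_pV2 ?posrE ?powR_gt0 //; last by lra.
by apply: ler_powR2r => //; lra.
Qed.

Lemma powR_opp_lt1 r x : 0 < r -> 1 < x -> x `^ (- r) < 1.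
Proof.
move=> r0 x1; rewrite powRN invf_lt1; last by rewrite powR_gt0 //; lra.
have <- : 1 `^ r = 1 :> R by rewrite powR1.
by apply: gt0_ltr_powR => //; rewrite nnegrE; lra.
Qed.

(** For y <= z <= 2y one has y^(1-p) <= 2^(p-1) z^(1-p), while z + y >= (3/2) z makes z^(1-p) lose
    at least the fraction 1 - (3/2)^(1-p) of itself. The constant is the quotient of the two. *)
Definition carleson_constant p := 2 `^ (p - 1) / (1 - (3 / 2) `^ (1 - p)).

Lemma perspective_drop p x y z : 1 < p -> 0 < y -> y <= z -> z <= 2 * y ->
  perspective p x y <=
  carleson_constant p *
    (perspective p x z - perspective p x (z + y)).
Proof.
move=> p1 y0 yz z2y; have z0 : 0 < z by lra.
have d0 : 0 < 1 - (3 / 2 : R) `^ (1 - p).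
  by rewrite subr_gt0 -opprB powR_opp_lt1 //; lra.
rewrite /carleson_constant /perspective -mulrBr mulrCA ler_wpM2l ?powR_ge0 //.
have h1 : y `^ (1 - p) <= 2 `^ (p - 1) * z `^ (1 - p).
  have -> : y `^ (1 - p) = 2 `^ (p - 1) * (2 * y) `^ (1 - p).
    rewrite powRM ?(ltW y0) // mulrA -powRD ?pnatr_eq0 ?implybT //.
    by rewrite (_ : p - 1 + (1 - p) = 0) ?powRr0 ?mul1r //; ring.
  rewrite ler_wpM2l ?powR_ge0 // -opprB powR_opp_antimono //; lra.
have h2 : (z + y) `^ (1 - p) <= (3 / 2) `^ (1 - p) * z `^ (1 - p).
  rewrite -powRM ?(ltW z0) //.
  rewrite -opprB powR_opp_antimono //; lra.
apply: le_trans h1 _; rewrite -mulrA ler_wpM2l ?powR_ge0 //.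
rewrite mulrC ler_pdivlMr //; lra.
Qed.
End powR_inequalities.

(** * Principal cubes and the Carleson embedding on trees *)

Section tree.
Variables (R : realType) (B : finType).
Implicit Types (P : pred (seq B)) (m f y : seq B -> R) (k : nat) (s : seq B) (th : R).

(* A word lists the choices of children from the last to the first: the children
   of [s] are the [b :: s]. *)
Definition tree_additive m := forall s, m s = \sum_b m (b :: s).

Fixpoint leaf_sum f k s : R :=
  if k is k'.+1 then \sum_b leaf_sum f k' (b :: s) else f s.

(** The recursion ends at the first stopping word of each branch, so the cubes counted are disjoint;
    [s] itself is never counted. *)
Fixpoint stop_mass P m k s : R :=
  if k is k'.+1 then
    \sum_b (if P (b :: s) then m (b :: s) else stop_mass P m k' (b :: s))
  else 0.

(** Unlike in [stop_mass], the recursion goes on below stopping words, so all their generations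
    count; [s] is again left out. *)
Fixpoint desc_sum P y k s : R :=
  if k is k'.+1 then
    \sum_b ((if P (b :: s) then y (b :: s) else 0) + desc_sum P y k' (b :: s))
  else 0.

(* The sum over the descendants [t] of [s], [k] levels below, of
   [th ^ N * m t], where [N] counts the stopping words between [s] and [t]. *)
Fixpoint exp_mass P (th : R) m k s : R :=
  if k is k'.+1 then
    \sum_b (if P (b :: s) then th else 1) * exp_mass P th m k' (b :: s)
  else m s.

Lemma leaf_sum_le f1 f2 k s : (forall s, f1 s <= f2 s) ->
  leaf_sum f1 k s <= leaf_sum f2 k s.
Proof.
by move=> f12; elim: k s => [|k IH] s //=; apply: ler_sum => b _.
Qed.

Lemma leaf_sumZ c f k s : leaf_sum (fun s => c * f s) k s = c * leaf_sum f k s.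
Proof.
by elim: k s => [|k IH] s //=; rewrite mulr_sumr; apply: eq_bigr => b _.
Qed.

Lemma desc_sum_ge0 P y k s : (forall s, 0 <= y s) -> 0 <= desc_sum P y k s.
Proof.
move=> y0; elim: k s => [|k IH] s //=; apply: sumr_ge0 => b _.
by rewrite addr_ge0 //; case: ifP.
Qed.

(** The exponent leaves the sum because r-th powers are superadditive for r >= 1. With r = q/p this
    uses p <= q. *)
Lemma desc_sum_le_powR P y1 y2 c r k s : 1 <= r -> 0 <= c ->
  (forall s, 0 <= y2 s) -> (forall s, y1 s <= c * y2 s `^ r) ->
  desc_sum P y1 k s <= c * desc_sum P y2 k s `^ r.
Proof.
move=> r1 c0 y0 y12; have r0 : r != 0 by rewrite gt_eqF //; lra.
elim: k s => [|k IH] s /=; first by rewrite powR0 // mulr0.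
pose x b := (if P (b :: s) then y2 (b :: s) else 0).
have x0 b : 0 <= x b by rewrite /x; case: ifP.
have z0 b : 0 <= desc_sum P y2 k (b :: s) by exact: desc_sum_ge0.
apply: (@le_trans _ _ (c * \sum_b (x b + desc_sum P y2 k (b :: s)) `^ r)).
  rewrite mulr_sumr; apply: ler_sum => b _.
  apply: (@le_trans _ _ (c * (x b `^ r + desc_sum P y2 k (b :: s) `^ r))).
    rewrite mulrDr lerD // /x; case: ifP => _ //.
    by rewrite powR0 // mulr0.
  rewrite ler_wpM2l //.
  have := @powR_sum R r bool (fun i => if i then x b else desc_sum P y2 k (b :: s)) r1.
  by rewrite !big_bool; apply; case.
by rewrite ler_wpM2l //; apply: powR_sum => // b; rewrite addr_ge0.
Qed.

Section sparse.
Variables (P : pred (seq B)) (m : seq B -> R) (e : R).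
Hypotheses (m0 : forall s, 0 <= m s) (am : tree_additive m)
  (me : forall k s, P s -> stop_mass P m k s <= e * m s).

(** Below a stopping child sparseness gives th (m + 2 th e m) <= 2 th m, which the [stop_mass] term
    pays for. So the number of stops is exponentially integrable, with base [th]. *)
Lemma exp_mass_le th k s : 0 <= th -> 2 * th * e <= 1 ->
  exp_mass P th m k s <= m s + 2 * th * stop_mass P m k s.
Proof.
move=> th0 the; elim: k s => [|k IH] s /=; first by rewrite mulr0 addr0.
rewrite am mulr_sumr -big_split /=; apply: ler_sum => b _.
case: ifPn => Pb; last by rewrite mul1r.
have := ler_wpM2l th0 (IH (b :: s)).
have th20 : 0 <= 2 * th by lra.
have := ler_wpM2l th20 (me k Pb).
have := m0 (b :: s); have := ler_wpM2r (m0 (b :: s)) the.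
by nra.
Qed.

Lemma exp_mass_stop_le th k s : 0 <= th -> 2 * th * e <= 1 -> P s ->
  exp_mass P th m k s <= 2 * m s.
Proof.
move=> th0 the Ps; have := exp_mass_le k s th0 the.
have th20 : 0 <= 2 * th by lra.
have := ler_wpM2l th20 (me k Ps).
have := m0 s; have := ler_wpM2r (m0 s) the.
by nra.
Qed.

(** Successive generations of stopping words decay geometrically with ratio [e], at most 1/2, so the
    first one carries at least half of the total. *)
Lemma desc_sum_mass_le k s : 2 * e <= 1 ->
  desc_sum P m k s <= 2 * stop_mass P m k s.
Proof.
move=> e1; elim: k s => [|k IH] s /=; first by rewrite mulr0.
rewrite mulr_sumr; apply: ler_sum => b _; case: ifPn => Pb; last first.
  by rewrite add0r.
have := IH (b :: s); have := me k Pb; have := m0 (b :: s).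
have := ler_wpM2r (m0 (b :: s)) e1; nra.
Qed.

Lemma desc_sum_mass_stop_le k s : 2 * e <= 1 -> P s ->
  desc_sum P m k s <= m s.
Proof.
move=> e1 Ps; have := desc_sum_mass_le k s e1; have := me k Ps; have := m0 s.
have := ler_wpM2r (m0 s) e1; nra.
Qed.

(* Carleson embedding, with Bellman function [V - perspective p G (m + M)]
   where [M s] is the mass of the stopping words below [s]. *)
Lemma carleson (p : R) (G V : seq B -> R) k s : 1 < p -> 2 * e <= 1 ->
  (forall s, 0 < m s) -> (forall s, 0 <= G s) ->
  tree_additive G -> tree_additive V ->
  (forall s, perspective p (G s) (m s) <= V s) ->
  desc_sum P (fun s => perspective p (G s) (m s)) k s <=
  carleson_constant p *
    (V s - perspective p (G s) (m s + desc_sum P m k s)).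
Proof.
move=> p1 e1 mp G0 aG aV GV.
have d0 : 0 < 1 - (3 / 2 : R) `^ (1 - p).
  by rewrite subr_gt0 -opprB powR_opp_lt1 //; lra.
have C0 : 0 < carleson_constant p by rewrite divr_gt0 // powR_gt0.
set C := carleson_constant p in C0 *.
elim: k s => [|k IH] s /=.
  by rewrite addr0 mulr_ge0 ?subr_ge0 // ltW.
pose mm b := m (b :: s) +
   ((if P (b :: s) then m (b :: s) else 0) + desc_sum P m k (b :: s)).
have mm0 b : 0 < mm b.
  by rewrite /mm ltr_wpDr // addr_ge0 ?desc_sum_ge0 //; case: ifP.
have sE : m s + \sum_b ((if P (b :: s) then m (b :: s) else 0) +
    desc_sum P m k (b :: s)) = \sum_b mm b.
  by rewrite [in LHS]am -big_split.
have smm : 0 < \sum_b mm b.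
  rewrite -sE ltr_wpDr // sumr_ge0 // => b _.
  by rewrite addr_ge0 ?desc_sum_ge0 //; case: ifP.
apply: (@le_trans _ _ (C * \sum_b (V (b :: s) - perspective p (G (b :: s)) (mm b)))).
  rewrite mulr_sumr; apply: ler_sum => b _; rewrite /mm.
  case: ifPn => Pb; last by rewrite !add0r.
  (* At a stopping child the mass argument grows once more by [m (b :: s)]. Sparseness keeps it in
     the range of [perspective_drop], so the resulting decrease of the perspective pays for the new
     summand. *)
  have M0 : 0 <= desc_sum P m k (b :: s) by exact: desc_sum_ge0.
  have Mm := desc_sum_mass_stop_le k e1 Pb.
  have := @perspective_drop R p (G (b :: s)) (m (b :: s))
    (m (b :: s) + desc_sum P m k (b :: s)) p1 (mp _).
  rewrite lerDl mulr_natl mulr2n lerD2l => /(_ M0 Mm).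
  have := IH (b :: s).
  rewrite -/C (addrAC (m (b :: s)) (desc_sum _ _ _ _)) addrA.
  by rewrite !mulrBr; lra.
(* [V] splits exactly over the children, and subadditivity of the perspective merges the remaining
   terms into that of [s]. *)
rewrite ler_pM2l // sumrB -aV lerD2l lerN2 sE (aG s).
exact: perspective_sum.
Qed.
End sparse.
End tree.

(** * Principal words: sparseness and domination of oscillations *)

Section principal.
Variables (R : realType) (B : finType) (A : R) (G mu : seq B -> R).
Hypotheses (A1 : 1 <= A) (G0 : forall s, 0 <= G s) (mu0 : forall s, 0 < mu s)
  (aG : tree_additive G).
Implicit Types (s : seq B) (k : nat).

Let g s := G s / mu s.

(* The average of the smallest stopping word above [s]. *)
Fixpoint principal_avg s : R :=
  if s is b :: s' then
    if A * principal_avg s' < g s then g s else principal_avg s'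
  else g s.

Definition principal : pred (seq B) := fun s =>
  if s is b :: s' then A * principal_avg s' < g s else true.

Arguments principal : simpl never.

Lemma principal_avg_stop s : principal s -> principal_avg s = g s.
Proof. by case: s => [|b s] //=; rewrite /principal => ->. Qed.

Lemma principal_avg_cons b s : ~~ principal (b :: s) ->
  principal_avg (b :: s) = principal_avg s.
Proof. by rewrite /principal /= => /negbTE ->. Qed.

Lemma avg_ge0 s : 0 <= g s.
Proof. by rewrite divr_ge0 // ltW. Qed.

Lemma principal_avg_ge0 s : 0 <= principal_avg s.
Proof.
by elim: s => [|b s IH] /=; [exact: avg_ge0|case: ifP => // _; exact: avg_ge0].
Qed.

Lemma avg_le_principal s : g s <= A * principal_avg s.
Proof.
case: s => [|b s] /=; first by rewrite ler_peMl // avg_ge0.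
by case: ltP => // _; rewrite ler_peMl // avg_ge0.
Qed.

(** Chebyshev's inequality: on each maximal stopping word below [s] the average exceeds
    [A * principal_avg s], and these words are disjoint. *)
Lemma stop_mass_principal_le k s :
  A * principal_avg s * stop_mass principal mu k s <= G s.
Proof.
elim: k s => [|k IH] s /=; first by rewrite mulr0.
rewrite mulr_sumr aG; apply: ler_sum => b _.
case: ifPn => Pb; last first.
  by have := IH (b :: s); rewrite (principal_avg_cons Pb).
by rewrite -ler_pdivlMr // ltW // [_ < _]Pb.
Qed.

(** Chebyshev's bound is void when the principal average vanishes. But where [G] is zero no word
    below can stop, because the stopping inequality is strict. *)
Lemma stop_mass_principal0 k s : G s = 0 -> stop_mass principal mu k s = 0.
Proof.
elim: k s => [|k IH] s //= Gs; apply: big1 => b _.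
have Gb : G (b :: s) = 0.
  apply/eqP; rewrite eq_le G0 andbT -Gs [leRHS]aG (bigD1 b) //= lerDl.
  by rewrite sumr_ge0.
rewrite IH //; case: ifP => //; rewrite /principal /g Gb mul0r ltNge.
by rewrite mulr_ge0 ?principal_avg_ge0 // (le_trans _ A1).
Qed.

Lemma stop_mass_principal k s : principal s ->
  stop_mass principal mu k s <= A^-1 * mu s.
Proof.
move=> Ps; have A0 : 0 < A by exact: lt_le_trans A1.
have [Gs|Gs] := eqVneq (G s) 0.
  by rewrite stop_mass_principal0 // mulr_ge0 ?invr_ge0 ?ltW.
have Gp : 0 < G s by rewrite lt_neqAle eq_sym Gs G0.
have := stop_mass_principal_le k s; rewrite (principal_avg_stop Ps) /g.
have gp : 0 < G s / mu s by rewrite divr_gt0.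
rewrite -[leRHS](divfK (lt0r_neq0 (mu0 s))) -mulrA mulrCA ler_pM2l //.
by rewrite ler_pdivlMl.
Qed.

Section dyadic_sums.
Variables (l : seq B -> R) (q th : R).
Hypotheses (l0 : forall s, 0 < l s) (lS : forall b s, l (b :: s) = l s / 2)
  (q1 : 1 <= q).

Let a s := l s * g s.

Fixpoint principal_sum s : R :=
  (if s is b :: s' then principal_sum s' else 0) +
  (if principal s then a s else 0).

Let a0 s : 0 <= a s.
Proof. by rewrite mulr_ge0 ?avg_ge0 // ltW. Qed.

Lemma principal_sum_ge0 s : 0 <= principal_sum s.
Proof.
by elim: s => [|b s IH] /=; [rewrite add0r|rewrite addr_ge0 //; case: ifP].
Qed.

(** Between two stops the averages stay below [A] times the principal one while the sides halve,
    which gives a geometric series. The subtracted term is the tail of that series still to be spent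
    below [s]; it is what lets the telescoping sum be bounded by induction. *)
Lemma osc_le_principal_sum kap (u : seq B -> R) : 0 <= kap ->
  (forall b s, `|u (b :: s) - u s| <= kap * a s) -> forall s,
  `|u s - u [::]| <= 2 * kap * A * (principal_sum s - l s * principal_avg s).
Proof.
move=> k0 uS; have A0 : 0 <= A by exact: le_trans A1.
elim=> [|b s IH].
  by rewrite subrr normr0 /= add0r /principal subrr mulr0.
have := ler_normD (u (b :: s) - u s) (u s - u [::]); rewrite subrKA.
move/le_trans; apply.
apply: (le_trans (lerD (uS b s) IH)).
have h : kap * a s <= kap * (A * (l s * principal_avg s)).
  rewrite ler_wpM2l // /a [leRHS]mulrCA ler_wpM2l ?avg_le_principal //.
  exact: ltW.
apply: (le_trans (lerD h (lexx _))).
suff : principal_sum s - l s / 2 * principal_avg s <=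
    principal_sum (b :: s) - l (b :: s) * principal_avg (b :: s).
  have c0 : 0 <= 2 * kap * A by rewrite !mulr_ge0.
  move=> /(ler_wpM2l c0); apply: le_trans.
  by rewrite le_eqVlt; apply/orP; left; apply/eqP; field.
(* At a stop the new summand of [principal_sum] finances the series that starts there; otherwise
   both sides are equal. *)
have [Pb|Pb] := boolP (principal (b :: s)).
  rewrite (principal_avg_stop Pb) [principal_sum (b :: s)]/= Pb.
  rewrite /a addrK lerBlDr lerDl mulr_ge0 ?principal_avg_ge0 //.
  by rewrite divr_ge0 // ltW.
rewrite (principal_avg_cons Pb) [principal_sum (b :: s)]/=.
by rewrite (negbTE Pb) addr0 lS.
Qed.

(** The outcome of applying (x + y)^q <= 2^q (x^q + y^q) repeatedly to [principal_sum], with th =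
    2^q: a summand acquires one factor [th] for every later stop. *)
Fixpoint weighted_sum s : R :=
  if s is b :: s' then
    if principal s then th * weighted_sum s' + a s `^ q else weighted_sum s'
  else a s `^ q.

Lemma principal_sum_powR_le s : th = 2 `^ q ->
  principal_sum s `^ q <= th * weighted_sum s.
Proof.
move=> thE; have th1 : 1 <= th.
  have : (2 : R) <= 2 `^ q by apply: le1r_powR => //; rewrite ler1n.
  by rewrite -thE => ?; lra.
have q0 : 0 <= q := le_trans ler01 q1.
elim: s => [|b s IH] /=; first by rewrite add0r ler_peMl // powR_ge0.
case: ifP => _; last by rewrite addr0.
apply: (le_trans (powRD_le q0 (principal_sum_ge0 s) (a0 _))).
by rewrite -thE ler_wpM2l ?lerD //; lra.
Qed.

(** After exchanging the sums, a stopping word contributes a^q times the mass below it with a factor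
    [th] per later stop. This is [exp_mass], which sparseness bounds by twice the weight of the
    word. *)
Lemma leaf_sum_weighted_le (w : seq B -> R) e k s :
  (forall s, 0 <= w s) -> tree_additive w -> 0 <= th -> 2 * th * e <= 1 ->
  (forall k s, principal s -> stop_mass principal w k s <= e * w s) ->
  leaf_sum (fun s => weighted_sum s * w s) k s <=
  weighted_sum s * exp_mass principal th w k s +
    2 * desc_sum principal (fun s => a s `^ q * w s) k s.
Proof.
move=> w0 aw th0 the we.
elim: k s => [|k IH] s; first by rewrite /= mulr0 addr0.
rewrite /= !mulr_sumr -big_split /=; apply: ler_sum => b _.
apply: (le_trans (IH _)); rewrite mulrDr addrA lerD2r.
rewrite [weighted_sum (b :: s)]/=.
have [Pb|Pb] := boolP (principal (b :: s)); last by rewrite mul1r mulr0 addr0.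
rewrite mulrDl -mulrA mulrCA lerD2l [leRHS]mulrCA ler_wpM2l ?powR_ge0 //.
exact: (exp_mass_stop_le w0 aw we).
Qed.

End dyadic_sums.
End principal.

(** * The two-weight inequality on a finite tree *)

Section tree_inequality.
Variables (R : realType) (B : finType) (p q A kap Kt ew es : R).
Variables (l mu w sg G V u : seq B -> R).
Hypotheses (p1 : 1 < p) (pq : p <= q) (A1 : 1 <= A) (kap0 : 0 <= kap)
  (Kt0 : 0 <= Kt) (hew : 2 * 2 `^ q * ew <= 1) (hes : 2 * es <= 1).
Hypotheses (l0 : forall s, 0 < l s) (lS : forall b s, l (b :: s) = l s / 2)
  (mu0 : forall s, 0 < mu s).
Hypotheses (w0 : forall s, 0 < w s) (sg0 : forall s, 0 < sg s)
  (G0 : forall s, 0 <= G s)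
  (aw : tree_additive w) (asg : tree_additive sg)
  (aG : tree_additive G) (aV : tree_additive V).
Hypotheses (GV : forall s, perspective p (G s) (sg s) <= V s)
  (hu : forall b s, `|u (b :: s) - u s| <= kap * (l s * (G s / mu s)))
  (hw : forall k s, principal A G mu s ->
          stop_mass (principal A G mu) w k s <= ew * w s)
  (hsg : forall k s, principal A G mu s ->
          stop_mass (principal A G mu) sg k s <= es * sg s)
  (test : forall s, (l s * (G s / mu s)) `^ q * w s <=
          Kt * perspective p (G s) (sg s) `^ (q / p)).

Lemma tree_inequality k :
  leaf_sum (fun s => `|u s - u [::]| `^ q * w s) k [::] <=
  (2 * kap * A) `^ q *
    (2 `^ q * (2 * (Kt * (carleson_constant p * V [::]) `^ (q / p)))).
Proof.
have q1 : 1 <= q := ltW (lt_le_trans p1 pq).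
have q0 : 0 <= q := le_trans ler01 q1.
have A0 : 0 <= A := le_trans ler01 A1.
have p0 : 0 < p := lt_trans ltr01 p1.
have r1 : 1 <= q / p by rewrite ler_pdivlMr ?mul1r.
have C0 : 0 < carleson_constant p.
  by rewrite divr_gt0 ?powR_gt0 // subr_gt0 -opprB powR_opp_lt1 ?subr_gt0 //; lra.
have c0 : 0 <= 2 * kap * A by rewrite !mulr_ge0.
have w0' s : 0 <= w s by exact: ltW.
have th0 : 0 <= (2 : R) `^ q by exact: powR_ge0.
pose D := principal_sum A G mu l.
pose F := weighted_sum A G mu l q (2 `^ q).
pose P := principal A G mu.
pose y s := perspective p (G s) (sg s).
have y0 s : 0 <= y s by exact: perspective_ge0.
apply: (@le_trans _ _ ((2 * kap * A) `^ q * (2 `^ q *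
    leaf_sum (fun s => F s * w s) k [::]))).
  rewrite -!leaf_sumZ; apply: leaf_sum_le => s.
  rewrite !mulrA ler_wpM2r // -mulrA.
  apply: (@le_trans _ _ ((2 * kap * A * D s) `^ q)).
    apply: ler_powR2r => //.
    apply: (le_trans (osc_le_principal_sum A1 G0 mu0 l0 lS kap0 hu s)).
    rewrite ler_wpM2l // lerBlDr lerDl mulr_ge0 ?(ltW (l0 s)) //.
    exact: principal_avg_ge0.
  have D0 : 0 <= D s by exact: principal_sum_ge0.
  rewrite powRM // ler_wpM2l ?powR_ge0 //.
  exact: (principal_sum_powR_le A G0 mu0 l0 q1).
rewrite ler_wpM2l ?powR_ge0 // ler_wpM2l //.
apply: (le_trans (leaf_sum_weighted_le l q k [::] w0' aw th0 hew hw)).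
have Pn : P [::] by [].
have := exp_mass_stop_le w0' aw hw k th0 hew Pn.
pose a s := l s * (G s / mu s).
move=> /(ler_wpM2l (powR_ge0 (a [::]) q)) h.
apply: (le_trans (lerD h (lexx _))).
rewrite mulrCA -mulrDr ler_wpM2l //.
(* The testing condition is applied to every stopping word, and the exponent q/p is pulled out of
   the sum. *)
have X := desc_sum_le_powR P k [::] r1 Kt0 y0 test.
apply: (le_trans (lerD (test [::]) X)); rewrite -mulrDr ler_wpM2l //.
have Y0 : 0 <= desc_sum P y k [::] by exact: desc_sum_ge0.
apply: (@le_trans _ _ ((y [::] + desc_sum P y k [::]) `^ (q / p))).
  have := @powR_sum R (q / p) bool
    (fun i => if i then y [::] else desc_sum P y k [::]) r1.
  by rewrite !big_bool; apply; case.
apply: ler_powR2r; [exact: le_trans ler01 r1|by rewrite addr_ge0|].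
have sg0' s : 0 <= sg s by exact: ltW.
have H := carleson sg0' asg hsg k [::] p1 hes sg0 G0 aG aV GV.
have M0 : 0 <= desc_sum P sg k [::] by exact: desc_sum_ge0.
have Msg := desc_sum_mass_stop_le sg0' hsg k hes Pn.
(* The root is a stopping word that [desc_sum] leaves out; one more drop of the perspective pays for
   it. *)
have := @perspective_drop R p (G [::]) (sg [::]) (sg [::] + desc_sum P sg k [::]) p1 (sg0 _).
rewrite lerDl mulr_natl mulr2n lerD2l => /(_ M0 Msg) H2.
apply: (le_trans (lerD H2 H)); rewrite -mulrDr ler_wpM2l ?(ltW C0) //.
have := perspective_ge0 p (G [::]) (sg [::] + desc_sum P sg k [::] + sg [::]).
rewrite /P; lra.
Qed.
End tree_inequality.

(** * Differentiability of Lipschitz functions on the line *)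

Section lipschitz_derivable.
Variables (R : realType) (f : R -> R) (L : R).
Hypothesis fL : forall x y, `|f x - f y| <= L * `|x - y|.
Local Notation lam := (@lebesgue_measure R).

(** Adding [L * x] makes the function nondecreasing, so that it has a Stieltjes measure; on
    intervals this is at most [2 * L] times the length. *)
Let h x := f x + L * x.

Let h_incr x y : x <= y -> 0 <= h y - h x <= 2 * L * (y - x).
Proof.
move=> xy; have := fL y x; rewrite (@ger0_norm _ (y - x)) ?subr_ge0 //.
by rewrite /h ler_norml => /andP[h1 h2]; apply/andP; split; lra.
Qed.

Let L0 : 0 <= L.
Proof. by have := fL 1 0; rewrite subr0 normr1 mulr1; exact: le_trans. Qed.

Let h_nd : {homo h : x y / x <= y}.
Proof. by move=> x y /h_incr /andP[]; rewrite subr_ge0. Qed.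

Let h_rc : right_continuous h.
Proof.
apply/right_continuousW => x; apply/cvgrPdist_le => e e0.
have L1 : 0 < 2 * L + 1 by move: L0 => ?; lra.
near=> t.
have h1 : `|h x - h t| <= (2 * L + 1) * `|x - t|.
  have [xt|/ltW tx] := leP x t.
    have /andP[] := h_incr xt; rewrite -subr_ge0 => a b.
    rewrite distrC (distrC x) !ger0_norm ?subr_ge0 ?h_nd //.
    by rewrite (le_trans b) // ler_wpM2r ?subr_ge0 // lerDl.
  have /andP[a b] := h_incr tx.
  rewrite !ger0_norm ?subr_ge0 ?h_nd //.
  by rewrite (le_trans b) // ler_wpM2r ?subr_ge0 // lerDl.
apply: (le_trans h1); rewrite mulrC -ler_pdivlMr //.
near: t; apply: cvgr_dist_le; first exact: cvg_id.
by rewrite divr_gt0.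
Unshelve. all: by end_near. Qed.

Let hc : cumulative R R := HB.pack_for (cumulative R R) h
  (isCumulative.Build R _ R h h_nd h_rc).

Let nu := lebesgue_stieltjes_measure hc.

Let wlength_le (A : set R) : ocitv A ->
  (wlength hc A <= (2 * L)%:E * wlength idfun A)%E.
Proof.
move=> /ocitvP[->|[[a b] /= ab ->]]; first by rewrite !wlength0 mule0.
rewrite !wlength_itv_bnd ?(ltW ab) //= -EFinM lee_fin.
by have /andP[_] := h_incr (ltW ab).
Qed.

(** Absolute continuity: both measures are infima over covers by half-open intervals, so a cover of
    small total length also makes [nu] small. *)
Let nu0 (A : set R) : measurable A -> lam A = 0%E -> nu A = 0%E.
Proof.
move=> mA lA; apply/eqP; rewrite eq_le measure_ge0 andbT.
apply/lee_addgt0Pr => e e0; rewrite add0e.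
have L1 : 0 < 2 * L + 1 by move: L0 => ?; lra.
have : (lam A < (e / (2 * L + 1))%:E)%E by rewrite lA lte_fin divr_gt0.
rewrite /lam /lebesgue_measure /lebesgue_stieltjes_measure /measure_extension.
move=> /ereal_inf_lt[_ [F [mF AF] <-]] Fe.
apply: (@le_trans _ _ (\sum_(k <oo) wlength hc (F k))%E).
  by apply: ereal_inf_lbound; exists F.
apply: (@le_trans _ _ (\sum_(k <oo) (2 * L)%:E * wlength idfun (F k))%E).
  apply: lee_nneseries => [k _ _|k _]; first exact: (wlength_ge0 hc).
  by apply: wlength_le; exact: mF.
rewrite nneseriesZl; last by move=> k _; exact: (@wlength_ge0 R idfun).
apply: (@le_trans _ _ ((2 * L)%:E * (e / (2 * L + 1))%:E)%E).
  by rewrite lee_wpmul2l ?lee_fin ?mulr_ge0 // ltW.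
rewrite -EFinM lee_fin mulrCA ler_piMr ?(ltW e0) //.
by rewrite ler_pdivrMr // mul1r lerDl.
Qed.

Let nu_itv (A : set R) : ocitv A -> nu A = wlength hc A.
Proof. exact: measurable_mu_extE. Qed.

(** Restricting to a bounded window makes the Stieltjes measure finite, so that it is a charge and
    has a density. The primitive of the density is [h] up to a constant, and it is derivable at
    Lebesgue points. *)
Let derivable_window (M : R) :
  {ae lam, forall x, x \in `]-M, M[ -> derivable f x 1}.
Proof.
pose I := `]-M, M]%classic.
have mI : measurable (I : set (measurableTypeR R)) by exact: measurable_itv.
have nuI : (nu I < +oo)%E.
  rewrite nu_itv; last exact: is_ocitv.
  by rewrite wlength_itv /= -EFinB; case: ifP; rewrite ltey.
pose nuM := charge_of_finite_measure (mfrestr mI nuI).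
have nul : nuM `<< lam.
  apply/null_content_dominatesP => A mA lA.
  rewrite /nuM /charge_of_finite_measure /= /mfrestr /mrestr.
  apply: nu0; first exact: measurableI.
  by apply: (subset_measure0 _ _ _ lA) => //; exact: measurableI.
pose g := fine \o Radon_Nikodym nuM lam.
have gE : EFin \o g = Radon_Nikodym nuM lam.
  by apply/funext => x /=; rewrite fineK // Radon_Nikodym_fin_num.
have ig : lam.-integrable setT (EFin \o g).
  by rewrite gE; exact: Radon_Nikodym_integrable.
have lg : locally_integrable setT g.
  by apply: open_integrable_locally => //; exact: openT.
have := lebesgue_differentiation lg.
apply: filterS; first exact: (ae_filter_ringOfSetsType lam).
move=> x lx; rewrite in_itv /= => /andP[Mx xM].
have ig' : lam.-integrable [set` Interval (BRight (- M)) (BRight (x + 1))]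
    (EFin \o g) by exact: integrableS ig.
have [] := @FTC1_lebesgue_pt R g (BRight (-M)) x (x + 1) _ ig' _ lx.
  by rewrite ltrDl.
  by rewrite lte_fin.
set F := (F in derivable F) => dF _.
have FE y : - M < y < M -> F y = h y - h (- M).
  move=> /andP[My yM]; rewrite /F /Rintegral.
  transitivity (fine (\int[lam]_(t in `](- M)%R, y]%classic) Radon_Nikodym nuM lam t)%E).
    by rewrite -gE.
  have mJ : measurable (`]-M, y]%classic : set (measurableTypeR R)).
    exact: measurable_itv.
  rewrite -(Radon_Nikodym_integral nul mJ).
  transitivity (fine (nu (`]- M, y]%classic `&` I))) => //.
  have -> : `]- M, y]%classic `&` I = `]- M, y]%classic.
    by apply: setIidl; apply: subset_itvl; rewrite bnd_simp ltW.
  rewrite nu_itv; last exact: is_ocitv.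
  by rewrite wlength_itv_bnd ?(ltW My).
have dL : derivable ( *%R L : R -> R) x 1.
  by apply: (@derivableZ _ _ _ (@id R)); exact: derivable_id.
have dh : derivable (F + cst (h (- M)) - ( *%R L)) x 1.
  apply: derivableB dL; apply: derivableD dF _; exact: derivable_cst.
apply: near_eq_derivable dh; rewrite ?oner_neq0 //.
have : x \in `]-M, M[ by rewrite in_itv /= Mx.
move=> /near_in_itvoo; apply: filterS => y; rewrite in_itv /= => yM.
rewrite !fctE FE // /h; ring.
Qed.

Lemma lipschitz_ae_derivable : {ae lam, forall x, derivable f x 1}.
Proof.
have := ae_foralln (fun m : nat => derivable_window m%:R).
apply: filterS.
move=> x /(_ (Num.bound `|x|)); apply.
by rewrite in_itv /= -ltr_norml; exact: le_lt_trans (archi_boundP _).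
Qed.
End lipschitz_derivable.

(** * Lebesgue measure on row vectors *)

Lemma lebesgue_measure_translation (R : realType) (c : R)
    (A : set (measurableTypeR R)) : measurable A ->
  lebesgue_measure ((fun x : R => x + c) @^-1` A) = lebesgue_measure A.
Proof.
move=> mA.
have mT : measurable_fun setT (fun x : measurableTypeR R => x + c : measurableTypeR R).
  exact: measurable_funD.
pose nu : {measure set (measurableTypeR R) -> \bar R} :=
  measure_function_pushforward__canonical__measure_function_Measure
    lebesgue_measure mT.
suff -> : lebesgue_measure A = nu A by [].
apply: lebesgue_measure_unique => // _ /ocitvP[->|[[a b] /= ab ->]].
  by rewrite !measure0.
rewrite lebesgue_measure_itv /= /nu /= /pushforward.
have -> : (fun x : measurableTypeR R => x + c : measurableTypeR R) @^-1` `]a, b]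
    = `]a - c, b - c]%classic.
  by apply/seteqP; split => x /=; rewrite !in_itv /= ltrBlDr lerBrDr.
rewrite lebesgue_measure_itv /= !lte_fin ltrD2r.
by rewrite -!EFinD opprB addrA subrK.
Qed.

Section rect.
Variable R : realType.
Local Notation lam := (@lebesgue_measure R).

Definition rect n (A : 'I_n -> set (measurableTypeR R)) : set 'rV[R]_n :=
  [set x | forall i, A i (x ord0 i)].

Lemma measurable_rect n (A : 'I_n -> set (measurableTypeR R)) :
  (forall i, measurable (A i)) -> measurable (rect A).
Proof.
move=> mA; rewrite (_ : rect A =
    \bigcap_(i in [set: 'I_n]) ((fun x : 'rV[R]_n => x ord0 i) @^-1` A i)).
  apply: fin_bigcap_measurable; first exact: finite_finset.
  move=> i _.
  by rewrite -[X in measurable X]setTI; apply: measurable_coord => //; exact: mA.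
apply/seteqP; split => [x Ax i _|x Ax i]; [exact: Ax|exact: (Ax i I)].
Qed.

Lemma borel_lebesgue_rect n (A : 'I_n -> set (measurableTypeR R)) :
  (forall i, measurable (A i)) ->
  borel_lebesgue R n (rect A) = (\prod_(i < n) lam (A i))%E.
Proof.
elim: n A => [|n IH] A mA.
  rewrite big_ord0 /= diracE; case: (boolP (_ \in _)) => //.
  by rewrite notin_setE => -[]; case.
rewrite big_ord_recl /= /lebesgue_step /pushforward.
rewrite (_ : _ @^-1` _ = A ord0 `*` rect (fun i => A (lift ord0 i))).
  rewrite product_measure1E; [by rewrite IH|by []|].
  exact: measurable_rect.
apply/seteqP; split => [[x y]|[x y]] /=.
  move=> Axy; split => [|i].
    by have := Axy ord0; rewrite -[_ ord0 ord0]/((uncons_rV (cons_rV (x, y))).1) cons_rVK.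
  have := Axy (lift ord0 i).
  have -> : cons_rV (x, y) ord0 (lift ord0 i) =
     (uncons_rV (cons_rV (x, y))).2 ord0 i by rewrite /= mxE.
  by rewrite cons_rVK.
move=> [Ax Ay] i; case: (unliftP ord0 i) => [j|] ->.
  have -> : cons_rV (x, y) ord0 (lift ord0 j) =
     (uncons_rV (cons_rV (x, y))).2 ord0 j by rewrite /= mxE.
  by rewrite cons_rVK; exact: Ay.
by rewrite -[_ ord0 ord0]/((uncons_rV (cons_rV (x, y))).1) cons_rVK.
Qed.

(** Boxes with measurable sides form a pi-system that generates the sigma-algebra, and the cubes
    [-k, k]^n exhaust the space with finite measure. This reduces invariance under translations and
    permutations of coordinates to boxes. *)
Lemma borel_lebesgue_unique n (m : {measure set 'rV[R]_n -> \bar R}) :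
  (forall A : 'I_n -> set (measurableTypeR R), (forall i, measurable (A i)) ->
    m (rect A) = (\prod_(i < n) lam (A i))%E) ->
  forall E, measurable E -> m E = borel_lebesgue R n E.
Proof.
move=> mE E mE'.
pose G := [set E : set 'rV[R]_n | exists2 A : 'I_n -> set (measurableTypeR R),
  (forall i, measurable (A i)) & E = rect A].
pose F (k : nat) := rect (fun _ : 'I_n => `[- k%:R, k%:R]%classic).
have mF k (i : 'I_n) : measurable (`[- k%:R, k%:R]%classic : set (measurableTypeR R)).
  exact: measurable_itv.
apply: (@measure_unique _ R 'rV[R]_n G F) => //.
- apply/seteqP; split => X.
    move=> mX; apply: (@smallest_sub _ _ _ _ _ _ X mX).
      exact: smallest_sigma_algebra.
    move=> Y; rewrite -bigcup_seq /= => -[i _ [B mB <-]].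
    rewrite setTI; apply: sub_sigma_algebra.
    exists (fun j => if j == i then B else setT).
      by move=> j; case: eqP.
    apply/seteqP; split => x /=.
      by move=> Bx j /=; case: eqP => // ->.
    by move=> /(_ i); rewrite eqxx.
  apply: smallest_sub; first exact: sigma_algebra_measurable.
  by move=> _ [A mA ->]; exact: measurable_rect.
- move=> _ _ [A mA ->] [B mB ->]; exists (fun i => A i `&` B i).
    by move=> i; exact: measurableI.
  apply/seteqP; split => x /=; first by move=> [Ax Bx] i; split.
  by move=> AB; split => i; have [] := AB i.
- by move=> k; exists (fun _ => `[- k%:R, k%:R]%classic) => // i; exact: mF.
- apply/seteqP; split => // x _.
  exists (Num.bound `|x|) => // i /=; rewrite in_itv /= -ler_norml.
  have : `|x ord0 i| <= `|x|.
    by rewrite /Num.Def.normr /= mx_normrE; apply: (le_bigmax _ _ (ord0, i)).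
  by move=> /le_trans; apply; rewrite ltW // archi_boundP.
- by move=> _ [A mA ->]; rewrite mE //; apply/esym; exact: borel_lebesgue_rect.
- move=> k; rewrite mE; last exact: mF.
  have lk : lam `[- k%:R, k%:R]%classic \is a fin_num.
    by rewrite lebesgue_measure_itv /=; case: ifP => _; rewrite -?EFinD.
  rewrite big_const; elim: #|_| => [|j IH] /=; first by rewrite ltry.
  by rewrite lte_mul_pinfty.
Qed.
End rect.

Section invariance.
Variables (R : realType) (n : nat).
Local Notation mB := (borel_lebesgue R n).

Lemma measurable_translation (a : 'rV[R]_n) :
  measurable_fun [set: 'rV[R]_n] (fun x => x + a).
Proof.
apply: measurable_fun_rV => i; under eq_fun do rewrite mxE.
by apply: measurable_funD => //; exact: measurable_coord.
Qed.

Lemma borel_lebesgue_translation (a : 'rV[R]_n) (E : set 'rV[R]_n) :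
  measurable E -> mB ((fun x => x + a) @^-1` E) = mB E.
Proof.
move=> mE.
pose nu : {measure set 'rV[R]_n -> \bar R} :=
  measure_function_pushforward__canonical__measure_function_Measure
    mB (measurable_translation a).
suff : nu E = mB E by [].
apply: borel_lebesgue_unique => // A mA.
have mA' i : measurable ((fun t : measurableTypeR R => t + a ord0 i : measurableTypeR R) @^-1` A i).
  have mT : measurable_fun setT
      (fun t : measurableTypeR R => t + a ord0 i : measurableTypeR R).
    exact: measurable_funD.
  by rewrite -[X in measurable X]setTI; exact: mT.
transitivity (mB (rect (fun i =>
    (fun t : measurableTypeR R => t + a ord0 i : measurableTypeR R) @^-1` A i))).
  rewrite /nu /= /pushforward; congr (borel_lebesgue R n _).
  by apply/seteqP; split => x Ax i; have := Ax i; rewrite /= mxE.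
rewrite borel_lebesgue_rect //; apply: eq_bigr => i _.
by rewrite lebesgue_measure_translation.
Qed.

Lemma measurable_col_perm (s : 'S_n) :
  measurable_fun [set: 'rV[R]_n] (fun x : 'rV[R]_n => col_perm s x).
Proof.
apply: measurable_fun_rV => i; under eq_fun do rewrite mxE.
exact: measurable_coord.
Qed.

Lemma borel_lebesgue_col_perm (s : 'S_n) (E : set 'rV[R]_n) :
  measurable E -> mB ((fun x : 'rV[R]_n => col_perm s x) @^-1` E) = mB E.
Proof.
move=> mE.
pose nu : {measure set 'rV[R]_n -> \bar R} :=
  measure_function_pushforward__canonical__measure_function_Measure
    mB (measurable_col_perm s).
suff : nu E = mB E by [].
apply: borel_lebesgue_unique => // A mA.
transitivity (mB (rect (fun i => A ((s^-1)%g i)))).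
  rewrite /nu /= /pushforward; congr (borel_lebesgue R n _).
  apply/seteqP; split => x Ax i.
    by have := Ax ((s^-1)%g i); rewrite /= mxE permKV.
  by have := Ax (s i); rewrite /= mxE permK.
rewrite borel_lebesgue_rect // [RHS](reindex_inj (@perm_inj _ s^-1%g)).
by apply: eq_bigr => i _.
Qed.

End invariance.

(** The measure is built by splitting off the first coordinate. A transposition brings coordinate
    [i] there, and Fubini integrates the null slices. *)
Lemma borel_lebesgue_line_null (R : realType) (n : nat) (i : 'I_n)
    (N : set 'rV[R]_n) : measurable N ->
  (forall x : 'rV[R]_n, lebesgue_measure
     [set s : measurableTypeR R | N (x + (s : R) *: delta_mx ord0 i)] = 0%E) ->
  borel_lebesgue R n N = 0%E.
Proof.
case: n i N => [[]//|n] i N mN N0.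
pose T (x : 'rV[R]_n.+1) := col_perm (tperm ord0 i) x.
rewrite -(borel_lebesgue_col_perm (tperm ord0 i)) // -/T /=.
rewrite /lebesgue_step /pushforward.
set E := _ @^-1` _.
have mE : measurable E.
  rewrite /E -[X in measurable X]setTI; apply: measurable_cons_rV => //.
  by rewrite -[X in measurable X]setTI; exact: measurable_col_perm.
(* The order of integration is exchanged, so that the inner sections run along the first
   coordinate. *)
transitivity ((lebesgue_measure \x^ borel_lebesgue R n)%E E).
  apply: product_measure_unique => // A B mA mB.
  exact: product_measure2E.
rewrite /product_measure2 [LHS]integral0_eq // => y _ /=.
rewrite -[RHS](N0 (T (cons_rV (0, y)))); congr lebesgue_measure.
have -> : ysection E y = [set s | N (T (cons_rV (s, y)))].
  by apply/seteqP; split => s; rewrite /ysection /= inE.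
apply/seteqP.
have H (s : measurableTypeR R) : T (cons_rV (s, y)) =
    T (cons_rV (0, y)) + (s : R) *: delta_mx ord0 i.
  apply/rowP => j; rewrite [LHS]mxE [RHS]mxE [X in X + _]mxE [X in _ + X]mxE.
  rewrite [X in _ + _ * X]mxE eqxx /=.
  have c0 (t : measurableTypeR R) : cons_rV (t, y) ord0 ord0 = t.
    by rewrite -[_ ord0 ord0]/((uncons_rV (cons_rV (t, y))).1) cons_rVK.
  have cS (t : measurableTypeR R) k : cons_rV (t, y) ord0 (lift ord0 k) = y ord0 k.
    rewrite (_ : cons_rV (t, y) ord0 (lift ord0 k) =
      (uncons_rV (cons_rV (t, y))).2 ord0 k); first by rewrite cons_rVK.
    by rewrite /= mxE.
  have [->|ji] := eqVneq j i.
    by rewrite tpermR !c0 mulr1 add0r.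
  rewrite mulr0 addr0; case: (unliftP ord0 (tperm ord0 i j)) => [k|] e.
    by rewrite e !cS.
  by move: ji; rewrite -(inj_eq (@perm_inj _ (tperm ord0 i))) e tpermR eqxx.
split => s /= Ns; [rewrite -H|rewrite H]; exact: Ns.
Qed.

(** * Partial derivatives of Lipschitz functions *)

Section row_topology.
Variables (R : realType) (n : nat).
Implicit Types (x y : 'rV[R]_n) (i : 'I_n).

Lemma rV_coord_le_norm x i : `|x ord0 i| <= `|x|.
Proof.
by rewrite [leRHS]/Num.Def.normr /= mx_normrE; apply: (le_bigmax _ _ (ord0, i)).
Qed.

Lemma rV_norm_le x (e : R) : 0 <= e -> (forall i, `|x ord0 i| <= e) -> `|x| <= e.
Proof.
move=> e0 xe; rewrite /Num.Def.normr /= mx_normrE bigmax_le //= => -[j i] _ /=.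
by rewrite ord1.
Qed.

Lemma rV_norm_lt x (e : R) : 0 < e -> (forall i, `|x ord0 i| < e) -> `|x| < e.
Proof.
move=> e0 xe; rewrite /Num.Def.normr /= mx_normrE; apply/bigmax_ltP.
by split => //= -[j i] _ /=; rewrite ord1.
Qed.

Lemma norm_delta_rV i : `|delta_mx ord0 i : 'rV[R]_n| = 1.
Proof.
apply/eqP; rewrite eq_le; apply/andP; split.
  apply: rV_norm_le => // j; rewrite mxE /=.
  by case: (_ == _); rewrite ?normr1 ?normr0.
by have := rV_coord_le_norm (delta_mx ord0 i) i; rewrite mxE !eqxx normr1.
Qed.

(** The sigma-algebra is generated by the coordinates, so an open set is exhibited as a countable
    union of boxes with rational centres and radii 1/(k+1). *)
Lemma open_measurable_rV (U : set 'rV[R]_n) : open U -> measurable U.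
Proof.
move=> oU.
pose box (zk : 'rV[rat]_n * nat) : set 'rV[R]_n := rect (fun i : 'I_n =>
  `](ratr (zk.1 ord0 i) : R) - zk.2.+1%:R^-1,
     ratr (zk.1 ord0 i) + zk.2.+1%:R^-1[%classic : set (measurableTypeR R)).
have mbox zk : measurable (box zk).
  by apply: measurable_rect => i; exact: measurable_itv.
have -> : U = \bigcup_(zk in [set zk | box zk `<=` U]) box zk.
  apply/seteqP; split => [x Ux|x [zk zkU]]; last exact: zkU.
  have /nbhs_ballP[e /= e0 eU] : nbhs x U by exact: open_nbhs_nbhs.
  have [k ke] : exists k : nat, 2 * k.+1%:R^-1 < e.
    exists (Num.bound (2 / e)); rewrite ltr_pdivrMr // mulrC -ltr_pdivrMr //.
    rewrite (lt_trans (archi_boundP _)) // ?divr_ge0 ?(ltW e0) //.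
    by rewrite ltr_nat.
  pose d : R := k.+1%:R^-1.
  have d0 : 0 < d by rewrite invr_gt0.
  have zP i : exists z : rat, ratr z \in `]x ord0 i - d, x ord0 i + d[.
    have [z] := @rat_in_itvoo R (x ord0 i - d) (x ord0 i + d) ltac:(lra).
    by exists z.
  have /choice[z zE] := zP.
  exists (\row_i z i, k) => /=.
    move=> y boxy; apply: eU; rewrite -ball_normE /=.
    apply: rV_norm_lt => // i; rewrite !mxE.
    have := boxy i; have := zE i; rewrite /= !in_itv /= mxE -/d.
    move=> /andP[a b] /andP[a' b']; rewrite ltr_norml.
    move: ke; rewrite -/d => ke.
    apply/andP; split; lra.
  move=> i /=; have := zE i; rewrite !in_itv /= mxE -/d => /andP[a b].
  by apply/andP; split; lra.
rewrite bigcup_mkcond; apply: countable_bigcupT_measurable => // zk.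
by case: ifP.
Qed.

Lemma continuous_measurable_rV (f : 'rV[R]_n -> R) :
  continuous f -> measurable_fun setT f.
Proof.
move=> cf; apply: (measurability _ (RGenOpens.measurableE R)).
move=> _ [_ [a [b ->] <-]]; rewrite setTI; apply: open_measurable_rV.
by move/continuousP : cf; apply; exact: interval_open.
Qed.

Lemma closed_measurable_rV (C : set 'rV[R]_n) : closed C -> measurable C.
Proof.
move=> cC; rewrite -[C]setCK; apply: measurableC; apply: open_measurable_rV.
by rewrite openC.
Qed.
End row_topology.

Lemma lipschitz_rV_continuous (R : realType) n (u : 'rV[R]_n -> R) (L : R) :
  0 <= L -> (forall x y, `|u x - u y| <= L * `|x - y|) -> continuous u.
Proof.
move=> L0 uL x A /nbhs_ballP[e /= e0 eA].
have L1 : 0 < L + 1 by lra.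
apply/nbhs_ballP; exists (e / (L + 1)); first by rewrite /= divr_gt0.
move=> y; rewrite -ball_normE /= ltr_pdivlMr // => xye.
apply: eA; rewrite -ball_normE /= (le_lt_trans (uL x y)) //.
by rewrite (le_lt_trans _ xye) // mulrC ler_wpM2l // lerDl.
Qed.

Section lipschitz.
Variables (R : realType) (n : nat) (u : 'rV[R]_n -> R) (L : R).
Hypotheses (L0 : 0 <= L) (uL : forall x y, `|u x - u y| <= L * `|x - y|).
Implicit Types (x y : 'rV[R]_n) (i : 'I_n).
Local Notation mB := (borel_lebesgue R n).

Lemma lipschitz_measurable : measurable_fun setT u.
Proof. apply: continuous_measurable_rV; exact: lipschitz_rV_continuous uL. Qed.

Definition quotient i (s : R) x := s^-1 * (u (s *: delta_mx ord0 i + x) - u x).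

Lemma quotient_le i s x : s != 0 -> `|quotient i s x| <= L.
Proof.
move=> s0; rewrite normrM normfV ler_pdivrMl ?normr_gt0 // mulrC.
apply: (le_trans (uL _ _)); rewrite addrK normrZ norm_delta_rV mulr1.
by [].
Qed.

Lemma lipschitz_quotient i s x y :
  `|quotient i s x - quotient i s y| <= `|s^-1| * (2 * L) * `|x - y|.
Proof.
rewrite /quotient -mulrBr normrM -mulrA ler_wpM2l //.
set e := s *: _.
rewrite (_ : _ - _ = (u (e + x) - u (e + y)) - (u x - u y)); last by ring.
rewrite (_ : 2 * L * _ = L * `|x - y| + L * `|x - y|); last by ring.
rewrite (le_trans (ler_normB _ _)) // lerD //.
by rewrite (le_trans (uL _ _)) // opprD addrACA subrr add0r.
Qed.

Lemma measurable_quotient i s : measurable_fun setT (quotient i s).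
Proof.
apply: continuous_measurable_rV.
by apply: lipschitz_rV_continuous (lipschitz_quotient i s); rewrite !mulr_ge0.
Qed.

Definition derivable_set i := [set x | derivable u x (delta_mx ord0 i)].

(** Cauchy's criterion for the difference quotients at zero. The innermost intersection is
    uncountable, but its members are closed, which makes the set measurable. *)
Lemma derivable_setE i : derivable_set i =
  \bigcap_(k : nat) \bigcup_(m : nat)
    \bigcap_(st in [set st : R * R | [/\ st.1 != 0, st.2 != 0,
       `|st.1| < m.+1%:R^-1 & `|st.2| < m.+1%:R^-1]])
      [set x | `|quotient i st.1 x - quotient i st.2 x| <= k.+1%:R^-1].
Proof.
apply/seteqP; split => x.
  move=> /cvg_ex[l]; rewrite /= => /cvgrPdist_le H k _.
  have e0 : 0 < (k.+1%:R^-1 / 2 : R) by rewrite divr_gt0.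
  have [d /= d0 Hd] := H _ e0.
  have [m md] : exists m : nat, m.+1%:R^-1 < d.
    exists (Num.bound d^-1); rewrite invf_plt ?posrE //.
    by rewrite (lt_trans (archi_boundP _)) ?invr_ge0 ?(ltW d0) // ltr_nat.
  exists m => // -[s t] /= [s0 t0 sm tm].
  have Hs : `|l - quotient i s x| <= k.+1%:R^-1 / 2.
    by apply: Hd => //; rewrite /ball_ /= sub0r normrN (lt_trans sm).
  have Ht : `|l - quotient i t x| <= k.+1%:R^-1 / 2.
    by apply: Hd => //; rewrite /ball_ /= sub0r normrN (lt_trans tm).
  rewrite distrC in Hs; rewrite -(subrKA l) (le_trans (ler_normD _ _)) //.
  by rewrite [leRHS]splitr lerD.
move=> H; apply/cauchy_cvgP; apply: cauchy_exP => e e0.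
have [k ke] : exists k : nat, k.+1%:R^-1 < e.
  exists (Num.bound e^-1); rewrite invf_plt ?posrE //.
  by rewrite (lt_trans (archi_boundP _)) ?invr_ge0 ?(ltW e0) // ltr_nat.
have [m _ Hm] := H k I.
have m0 : 0 < (m.+1%:R^-1 : R) by rewrite invr_gt0.
exists (quotient i (m.+1%:R^-1 / 2) x).
suff : \forall a \near (0 : R)^',
  ball (quotient i (m.+1%:R^-1 / 2) x) e (quotient i a x) by [].
near=> a; rewrite -ball_normE /=; apply: le_lt_trans ke.
suff ha : [/\ (m.+1%:R^-1 / 2 : R) != 0, a != 0,
    `|m.+1%:R^-1 / 2| < (m.+1%:R^-1 : R) & `|a| < m.+1%:R^-1].
  exact: (Hm (m.+1%:R^-1 / 2, a) ha).
split.
- by rewrite gt_eqF // divr_gt0.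
- by near: a; exact: nbhs_dnbhs_neq.
- by rewrite gtr0_norm ?divr_gt0 // ltr_pdivrMr // ltr_pMr // ltr1n.
- by near: a; exact: dnbhs0_lt.
Unshelve. all: by end_near. Qed.

Lemma measurable_derivable_set i : measurable (derivable_set i).
Proof.
rewrite derivable_setE; apply: bigcapT_measurable => k.
apply: bigcupT_measurable => m; apply: closed_measurable_rV.
apply: closed_bigI => -[s t] _ /=.
rewrite (_ : mkset _ = (fun x => `|quotient i s x - quotient i t x|) @^-1`
  [set r | r <= k.+1%:R^-1]) //.
apply: closed_comp; last exact: closed_le.
move=> x _; move: x; apply: (@lipschitz_rV_continuous _ _ _
  ((`|s^-1| + `|t^-1|) * (2 * L))) => [|x y].
  by rewrite !mulr_ge0 ?addr_ge0.
rewrite (le_trans (ler_dist_dist _ _)) // mulrDl mulrDl.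
rewrite (_ : _ - _ = (quotient i s x - quotient i s y) -
  (quotient i t x - quotient i t y)); last by ring.
by rewrite (le_trans (ler_normB _ _)) // lerD // lipschitz_quotient.
Qed.

Lemma derivable_set_null i : mB (~` derivable_set i) = 0%E.
Proof.
apply: (borel_lebesgue_line_null (i := i)) => [|x].
  by apply: measurableC; exact: measurable_derivable_set.
pose f (s : R) := u (x + s *: delta_mx ord0 i).
have fL s t : `|f s - f t| <= L * `|s - t|.
  rewrite (le_trans (uL _ _)) // opprD addrACA subrr add0r -scalerBl.
  by rewrite normrZ norm_delta_rV mulr1.
have [N [mN N0 fN]] := lipschitz_ae_derivable fL.
apply: (subset_measure0 _ mN _ N0); last first.
  move=> s /= Ns; apply: fN => /= df; apply: Ns.
  rewrite /derivable_set /= /derivable.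
  move: df; rewrite /derivable.
  set g1 := (X in cvg (X @ _)); set g2 := (X in _ -> cvg (X @ _)).
  suff -> : g1 = g2 by [].
  apply/funext => h; rewrite /g1 /g2 /f /= -[h *: 1]/(h * 1) mulr1.
  by congr (_ *: (u _ - _)); rewrite scalerDl addrCA.
have mT : measurable_fun setT
    (fun s : measurableTypeR R => x + (s : R) *: delta_mx ord0 i).
  apply: measurable_fun_rV => j; under eq_fun do rewrite !mxE.
  apply: measurable_funD => //.
  exact: measurable_funM.
rewrite -[X in measurable X]setTI; apply: mT => //.
by apply: measurableC; exact: measurable_derivable_set.
Qed.

(** Set to zero where the derivative fails, so as to be measurable and bounded by [L] everywhere. *)
Definition partial i : 'rV[R]_n -> R :=
  (fun x => 'D_(delta_mx ord0 i) u x) \_ (derivable_set i).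

Lemma quotient_cvg i x (h : R^nat) : derivable_set i x ->
  (forall k, h k != 0) -> h k @[k --> \oo] --> 0 ->
  quotient i (h k) x @[k --> \oo] --> partial i x.
Proof.
move=> Dx h0 hc; rewrite /partial patchE mem_set //.
have H : quotient i s x @[s --> (0 : R)^'] --> 'D_(delta_mx ord0 i) u x by [].
by move/cvgr_dnbhsP : H; apply.
Qed.

Lemma partial_le i x : `|partial i x| <= L.
Proof.
rewrite /partial patchE; case: ifPn => [|_]; last by rewrite normr0.
rewrite inE => Dx.
have h0 k : (k.+1%:R^-1 : R) != 0 by rewrite gt_eqF.
have := quotient_cvg Dx h0 (@cvg_harmonic R).
rewrite /partial patchE mem_set // => H.
have {}H : `|quotient i k.+1%:R^-1 x| @[k --> \oo] -->
    `|'D_(delta_mx ord0 i) u x| by exact: cvg_norm.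
rewrite -(cvg_lim _ H) //; apply: limr_le.
  by apply/cvg_ex; exists `|'D_(delta_mx ord0 i) u x|.
by apply: nearW => k; exact: quotient_le.
Qed.

Lemma measurable_partial i : measurable_fun setT (partial i).
Proof.
apply: (@measurable_fun_cvg _ _ _ setT
  (fun k x => \1_(derivable_set i) x * quotient i k.+1%:R^-1 x)).
  move=> k; apply: measurable_funM; last exact: measurable_quotient.
  by apply: measurable_indic; exact: measurable_derivable_set.
move=> x _; have [Dx|Dx] := pselect (derivable_set i x).
  under eq_fun do rewrite indicE mem_set // mul1r.
  by apply: quotient_cvg => //; exact: cvg_harmonic.
under eq_fun do rewrite indicE memNset // mul0r.
by rewrite /partial patchE memNset //; exact: cvg_cst.
Qed.

Section translated_integral.
Variables (i : 'I_n) (E : set 'rV[R]_n) (M : R).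
Hypotheses (mE : measurable E) (Efin : (mB E < +oo)%E)
  (EM : forall x, E x -> `|x| <= M).
Local Notation e := (delta_mx ord0 i : 'rV[R]_n).

Let mtr (f : 'rV[R]_n -> R) s : measurable_fun setT f ->
  measurable_fun E (fun x => f (x + s *: e)).
Proof.
move=> mf; apply: measurable_funTS; apply: measurableT_comp => //.
exact: measurable_translation.
Qed.

Let bounded_integrable (f : 'rV[R]_n -> R) C : measurable_fun E f ->
  (forall x, E x -> `|f x| <= C) -> mB.-integrable E (EFin \o f).
Proof.
move=> mf fC; apply: measurable_bounded_integrable => //.
exists C; split; first exact: num_real.
by move=> D CD x Ex /=; rewrite (le_trans (fC x Ex)) // ltW.
Qed.

Let integrable_u s : mB.-integrable E (EFin \o (fun x => u (x + s *: e))).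
Proof.
apply: (bounded_integrable (C := `|u 0| + L * (M + `|s|))).
  by apply: mtr; exact: lipschitz_measurable.
move=> x Ex; rewrite -[u _](subrK (u 0)) addrC (le_trans (ler_normD _ _)) // lerD //.
rewrite (le_trans (uL _ _)) // subr0 ler_wpM2l // (le_trans (ler_normD _ _)) //.
by rewrite lerD ?EM // normrZ norm_delta_rV mulr1.
Qed.

Definition translated_integral (s : R) : R := (\int[mB]_(x in E) u (x + s *: e))%R.

Lemma translated_integral_derive (s : R) :
  is_derive s (1 : R) translated_integral
    (\int[mB]_(x in E) partial i (x + s *: e)).
Proof.
set l := (\int[mB]_(x in E) _).
suff H : (fun h => h^-1 *: ((translated_integral \o shift s) (h *: 1) -
    translated_integral s)) @ (0 : R)^' --> l.
  by apply: DeriveDef; [apply/cvg_ex; exists l|exact: cvg_lim].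
apply/cvgr_dnbhsP => h [h0 hc].
have qE k : (h k)^-1 *: ((translated_integral \o shift s) (h k *: 1) -
    translated_integral s) =
    fine (\int[mB]_(x in E) (quotient i (h k) (x + s *: e))%:E)%E.
  rewrite /= /translated_integral -RintegralB //.
  rewrite -[_ *: _]/(_ * _) -RintegralZl //; last first.
    exact: (integrableB mE (integrable_u _) (integrable_u _)).
  congr (fine _); apply: eq_integral => x _; rewrite /quotient.
  by rewrite -[h k *: 1]/(h k * 1) mulr1 scalerDl addrCA addrA.
rewrite (_ : (fun n : nat => _) = fun k => fine (\int[mB]_(x in E)
  (quotient i (h k) (x + s *: e))%:E)%E); last by apply/funext.
apply: fine_cvg; rewrite fineK; last first.
  apply: integrable_fin_num => //.
  apply: (bounded_integrable (f := fun x => partial i (x + s *: e)) (C := L)).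
    by apply: mtr; exact: measurable_partial.
  by move=> x _; exact: partial_le.
have := @dominated_convergence _ _ R mB E mE
  (fun k x => (quotient i (h k) (x + s *: e))%:E)
  (fun x => (partial i (x + s *: e))%:E) (cst L%:E).
case => //.
- move=> k; apply/measurable_EFinP; apply: (@mtr (quotient i (h k))).
  exact: measurable_quotient.
- apply/measurable_EFinP; apply: (@mtr (partial i)).
  exact: measurable_partial.
(* Convergence fails at most on a translate of the null set of points without derivative. *)
- exists ((fun x => x + s *: e) @^-1` (~` derivable_set i)); split.
  + rewrite -[X in measurable X]setTI; apply: measurable_translation => //.
    by apply: measurableC; exact: measurable_derivable_set.
  + rewrite -[RHS](derivable_set_null i); apply: borel_lebesgue_translation.
    by apply: measurableC; exact: measurable_derivable_set.
  + move=> x /= H Dx; apply: H => Ex.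
    by apply: cvg_EFin; [exact: nearW|exact: quotient_cvg].
- apply: (bounded_integrable (f := cst L) (C := `|L|)) => //.
- by apply: aeW => x k Ex /=; rewrite lee_fin quotient_le.
Qed.

(** The mean value theorem puts the whole increment on a single translate of [E], by some [c]
    between 0 and [h]; this translate lies in [Q], and translation invariance moves the integral
    onto it. *)
Lemma translated_integral_le (Q : set 'rV[R]_n) (h : R) :
  measurable Q -> 0 <= h ->
  (forall s x, 0 <= s <= h -> E x -> Q (x + s *: e)) ->
  (`|translated_integral h - translated_integral 0|%:E <=
   h%:E * \int[mB]_(x in Q) `|partial i x|%:E)%E.
Proof.
move=> mQ h0 EQ.
have cU : {within `[0, h], continuous translated_integral}.
  apply: derivable_within_continuous => s _.
  exact: (@ex_derive _ _ _ _ _ _ _ (translated_integral_derive s)).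
have [c] := MVT_segment h0 (fun s _ => translated_integral_derive s) cU.
rewrite in_itv /= subr0 => ch ->.
rewrite normrM (ger0_norm h0) mulrC EFinM lee_wpmul2l ?lee_fin //.
have mpc : measurable_fun E (fun x => partial i (x + c *: e)).
  by apply: (@mtr (partial i)); exact: measurable_partial.
have ipc : mB.-integrable E (EFin \o fun x => partial i (x + c *: e)).
  by apply: (bounded_integrable (C := L)) mpc _ => x _; exact: partial_le.
rewrite EFin_normr_Rintegral //.
apply: (le_trans (le_abse_integral _ mE _)); first exact/measurable_EFinP.
pose D := (fun x : 'rV[R]_n => x - c *: e) @^-1` E.
have mD : measurable D.
  rewrite -[X in measurable X]setTI; exact: (measurable_translation _ measurableT).
have DE : (fun x : 'rV[R]_n => x + c *: e) @^-1` D = E.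
  by apply/seteqP; split => x; rewrite /D /= addrK.
have mabs : measurable_fun setT (fun x => `|(partial i x)%:E|%E).
  by apply/measurable_EFinP; apply: measurableT_comp => //; exact: measurable_partial.
have := @ge0_integral_pushforward _ _ _ _ R _ (measurable_translation (c *: e))
  mB D (fun x => `|(partial i x)%:E|%E) mD.
rewrite DE => <- //; last exact: measurable_funTS.
pose nu : {measure set 'rV[R]_n -> \bar R} :=
  measure_function_pushforward__canonical__measure_function_Measure
    mB (measurable_translation (c *: e)).
rewrite -[X in (X <= _)%E]/(\int[nu]_(y in D) `|(partial i y)%:E|)%E.
rewrite [X in (X <= _)%E](@eq_measure_integral _ _ _ _ mB); last first.
  by move=> A mA _; exact: borel_lebesgue_translation.
apply: ge0_subset_integral => //; first exact: measurable_funTS.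
by move=> x Dx; have := EQ c _ ch Dx; rewrite subrK.
Qed.
End translated_integral.
End lipschitz.

(** * Cubes *)

Section completion.
Variables (R : realType) (n : nat).
Local Notation mB := (borel_lebesgue R n).
Local Notation mu := (lebesgue_rV R n).
Local Notation LT := (lebesgue_type R n).

Lemma borel_lebesgue_measurable (E : set 'rV[R]_n) :
  measurable E -> measurable (E : set LT).
Proof. by move=> mE; apply: sub_caratheodory; exact: sub_sigma_algebra. Qed.

Lemma lebesgue_rVE (E : set 'rV[R]_n) : measurable E -> mu E = mB E.
Proof. exact: measurable_mu_extE. Qed.

(** As a map from the completed space to the Borel one, the identity is measurable and pushes [mu]
    forward to [mB]; integrals of Borel functions are transferred along it. *)
Let idL (x : LT) : 'rV[R]_n := x.

Let measurable_idL : measurable_fun setT idL.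
Proof.
by move=> _ E mE; rewrite setTI; apply: borel_lebesgue_measurable.
Qed.

Lemma measurable_fun_completion d (T : measurableType d) (f : 'rV[R]_n -> T)
    (E : set 'rV[R]_n) :
  measurable_fun setT f -> measurable_fun (E : set LT) (f : LT -> T).
Proof.
by move=> mf; apply: measurable_funTS; exact: (measurableT_comp mf measurable_idL).
Qed.

Lemma ge0_integral_lebesgue_rV (E : set 'rV[R]_n) (f : 'rV[R]_n -> \bar R) :
  measurable E -> measurable_fun setT f -> (forall x, 0 <= f x)%E ->
  (\int[mu]_(x in E) f x = \int[mB]_(x in E) f x)%E.
Proof.
move=> mE mf f0.
rewrite -[LHS]/(\int[mu]_(x in idL @^-1` E) (f \o idL) x)%E.
rewrite -ge0_integral_pushforward //; last first.
  exact: measurable_funTS.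
pose nu : {measure set 'rV[R]_n -> \bar R} :=
  measure_function_pushforward__canonical__measure_function_Measure
    mu measurable_idL.
rewrite -[LHS]/(\int[nu]_(y in E) f y)%E.
by apply: eq_measure_integral => A mA _; exact: lebesgue_rVE.
Qed.

Lemma Rintegral_lebesgue_rV (E : set 'rV[R]_n) (f : 'rV[R]_n -> R) :
  measurable E -> measurable_fun setT f -> mu.-integrable (E : set LT) (EFin \o f) ->
  \int[mu]_(x in E) f x = \int[mB]_(x in E) f x.
Proof.
move=> mE mf fi; congr fine.
rewrite -[LHS]/(\int[mu]_(x in idL @^-1` E) ((EFin \o f) \o idL) x)%E.
rewrite -integral_pushforward //; last exact/measurable_EFinP.
pose nu : {measure set 'rV[R]_n -> \bar R} :=
  measure_function_pushforward__canonical__measure_function_Measure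
    mu measurable_idL.
rewrite -[LHS]/(\int[nu]_(y in E) (f y)%:E)%E.
by apply: eq_measure_integral => A mA _; exact: lebesgue_rVE.
Qed.
End completion.

Section cubes.
Variables (R : realType) (n : nat).
Local Notation mB := (borel_lebesgue R n).
Local Notation mu := (lebesgue_rV R n).
Local Notation LT := (lebesgue_type R n).
Implicit Types (a x : 'rV[R]_n) (l : R).

Lemma cube_rect a l : cube a l =
  rect (fun i => `[a ord0 i, a ord0 i + l[%classic : set (measurableTypeR R)).
Proof. by apply/seteqP; split => x ax i; have := ax i; rewrite /= in_itv. Qed.

Lemma measurable_cube a l : measurable (cube a l).
Proof.
by rewrite cube_rect; apply: measurable_rect => i; exact: measurable_itv.
Qed.

Lemma borel_lebesgue_cube a l : 0 < l -> mB (cube a l) = (l ^+ n)%:E.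
Proof.
move=> l0; rewrite cube_rect borel_lebesgue_rect; last first.
  by move=> i; exact: measurable_itv.
rewrite (eq_bigr (fun=> l%:E)).
  by rewrite prodEFin prodr_const card_ord.
move=> i _; rewrite lebesgue_measure_itv /= lte_fin ltrDl l0.
by rewrite -EFinD addrAC subrr add0r.
Qed.

Lemma lebesgue_rV_cube a l : 0 < l -> mu (cube a l) = (l ^+ n)%:E.
Proof.
by move=> l0; rewrite lebesgue_rVE ?borel_lebesgue_cube //; exact: measurable_cube.
Qed.

Lemma cube_norm_le a l x : 0 < l -> cube a l x -> `|x| <= `|a| + l.
Proof.
move=> l0 ax; apply: rV_norm_le => [|i]; first by rewrite addr_ge0 // ltW.
have /andP[h1 h2] := ax i; have := rV_coord_le_norm a i.
by rewrite !ler_norml => /andP[h3 h4]; apply/andP; split; lra.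
Qed.

Lemma cube_diam_le a l x y : 0 < l -> cube a l x -> cube a l y -> `|x - y| <= l.
Proof.
move=> l0 ax ay; apply: rV_norm_le => [|i]; first exact: ltW.
have /andP[h1 h2] := ax i; have /andP[h3 h4] := ay i; rewrite !mxE.
by rewrite ler_norml; apply/andP; split; lra.
Qed.

(** Cubes are half-open, so off the lower faces every point is interior and difference quotients
    with small increments only see the cube. *)
Lemma cube_boundary_negligible a l : 0 < l ->
  mu.-negligible (cube a l `\` [set x | forall i, a ord0 i < x ord0 i]).
Proof.
move=> l0.
pose F (i : 'I_n) := rect (fun j : 'I_n => if j == i then [set a ord0 i]
  else `[a ord0 j, a ord0 j + l[%classic : set (measurableTypeR R)).
have mF i : measurable (F i).
  apply: measurable_rect => j; case: eqP => _.
    exact: measurable_set1.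
  exact: measurable_itv.
have F0 i : mu (F i) = 0%E.
  rewrite lebesgue_rVE // borel_lebesgue_rect; last first.
    move=> j; case: eqP => _; first exact: measurable_set1.
    exact: measurable_itv.
  by rewrite (bigD1 i) //= eqxx lebesgue_measure_set1 mul0e.
pose F' (k : nat) := if insub k is Some i then F i else set0.
have : mu.-negligible (\bigcup_k F' k).
  apply: negligible_bigcup => k; rewrite /F'.
  case: insubP => [i _ _|_]; last exact: negligible_set0.
  by exists (F i); split => //; exact: borel_lebesgue_measurable.
apply: negligibleS => x [ax /= /existsNP[i /negP]]; rewrite -leNgt => xi.
have xiE : x ord0 i = a ord0 i.
  by apply/eqP; rewrite eq_le xi; have /andP[-> _] := ax i.
exists i => //; rewrite /F' valK => j /=; case: eqP => [->//|_].
by rewrite /= in_itv; exact: ax.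
Qed.

Definition subcube_corner a l (b : 'I_n -> bool) : 'rV[R]_n :=
  \row_i (a ord0 i + (b i)%:R * (l / 2)).

Definition subcube a l (b : 'I_n -> bool) := cube (subcube_corner a l b) (l / 2).

Lemma subcube_sub a l b : 0 < l -> subcube a l b `<=` cube a l.
Proof.
move=> l0 x bx i; have /andP[] := bx i; rewrite mxE.
by case: (b i); rewrite ?mul1r ?mul0r => h1 h2; apply/andP; split; lra.
Qed.

Lemma cube_bigcup a l : 0 < l ->
  cube a l = \bigcup_(b in [set: {ffun 'I_n -> bool}]) subcube a l b.
Proof.
move=> l0; apply/seteqP; split => [x ax|x [b _]]; last exact: subcube_sub.
exists [ffun i => a ord0 i + l / 2 <= x ord0 i] => // i.
have /andP[h1 h2] := ax i; rewrite mxE ffunE.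
by case: (leP (a ord0 i + l / 2)) => h; rewrite ?mul1r ?mul0r; apply/andP; split; lra.
Qed.

Lemma subcube_disjoint a l (b c : {ffun 'I_n -> bool}) : 0 < l ->
  subcube a l b `&` subcube a l c !=set0 -> b = c.
Proof.
move=> l0 [x [bx cx]]; apply/ffunP => i.
have /andP[h1 h2] := bx i; have /andP[h3 h4] := cx i.
move: h1 h2 h3 h4; rewrite !mxE.
by case: (b i); case: (c i) => //; rewrite !(mul1r, mul0r) => *; exfalso; lra.
Qed.

Lemma trivIset_subcube a l (D : set {ffun 'I_n -> bool}) : 0 < l ->
  trivIset D (fun b => subcube a l b).
Proof. by move=> l0 b c _ _; exact: subcube_disjoint. Qed.
End cubes.

Section finite_unions.
Context d (T : measurableType d) (R : realType) (m : {measure set T -> \bar R}).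
Variables (I : finType) (F : I -> set T).
Hypotheses (mF : forall i, measurable (F i)) (tF : trivIset setT F).

Let bigcupE : \bigcup_i F i = \big[setU/set0]_i F i.
Proof.
rewrite -bigcup_seq; congr (bigcup _ F); apply/seteqP; split => // i _ /=.
exact: mem_index_enum.
Qed.

Let tF' : trivIset [set` index_enum I] F.
Proof. exact: sub_trivIset tF. Qed.

Lemma integral_fin_bigcup (f : T -> R) : measurable_fun (\bigcup_i F i) f ->
  (\int[m]_(x in \bigcup_i F i) (f x)%:E =
   \sum_i \int[m]_(x in F i) (f x)%:E)%E.
Proof.
rewrite bigcupE => mf; apply: integral_bigsetU_EFin => //.
  exact: index_enum_uniq.
exact/measurable_EFinP.
Qed.
End finite_unions.

(** * Oscillation of averages over subcubes *)

Section oscillation.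
Variables (R : realType) (n : nat) (u : 'rV[R]_n -> R) (L : R).
Hypotheses (L0 : 0 <= L) (uL : forall x y, `|u x - u y| <= L * `|x - y|).
Local Notation mB := (borel_lebesgue R n).

(** A substitute for [enorm (gradient u x)] that is measurable and bounded on the whole space. *)
Definition partial_norm x : R := enorm (\row_i partial u i x).

Lemma partial_norm_ge0 x : 0 <= partial_norm x.
Proof. exact: sqrtr_ge0. Qed.

Lemma partial_le_norm i x : `|partial u i x| <= partial_norm x.
Proof.
rewrite -sqrtr_sqr; apply: ler_wsqrtr; rewrite (bigD1 i) //= mxE lerDl.
by apply: sumr_ge0 => j _; exact: sqr_ge0.
Qed.

Lemma measurable_partial_norm : measurable_fun setT partial_norm.
Proof.
rewrite (_ : partial_norm = (fun t => t `^ 2^-1) \o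
  (fun x => \sum_i partial u i x ^+ 2)); last first.
  apply/funext => x /=; rewrite /partial_norm /enorm -powR12_sqrt.
    by congr (_ `^ _); apply: eq_bigr => i _; rewrite mxE.
  by apply: sumr_ge0 => i _; exact: sqr_ge0.
apply: measurableT_comp => //; apply: measurable_sum => i.
by apply: measurable_funX; exact: (measurable_partial L0 uL).
Qed.

Lemma partial_norm_le x : partial_norm x <= Num.sqrt (n%:R * L ^+ 2).
Proof.
apply: ler_wsqrtr; apply: (@le_trans _ _ (\sum_(i < n) L ^+ 2)).
  apply: ler_sum => i _; rewrite mxE -real_normK ?num_real //.
  by rewrite ler_pXn2r ?nnegrE // (partial_le L0 uL).
by rewrite sumr_const card_ord mulr_natl.
Qed.

Lemma borel_lebesgue_cube_fin (a : 'rV[R]_n) l : 0 < l ->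
  (mB (cube a l) < +oo)%E.
Proof. by move=> l0; rewrite borel_lebesgue_cube // ltry. Qed.

Lemma bounded_integrable_cube (f : 'rV[R]_n -> R) C a l : 0 < l ->
  measurable_fun setT f -> (forall x, cube a l x -> `|f x| <= C) ->
  mB.-integrable (cube a l) (EFin \o f).
Proof.
move=> l0 mf fC; apply: measurable_bounded_integrable.
- exact: measurable_cube.
- exact: borel_lebesgue_cube_fin.
- exact: measurable_funTS.
- exists C; split; first exact: num_real.
  by move=> D CD x Qx /=; rewrite (le_trans (fC x Qx)) // ltW.
Qed.

Lemma integrable_lipschitz_cube a l : 0 < l ->
  mB.-integrable (cube a l) (EFin \o u).
Proof.
move=> l0; apply: (bounded_integrable_cube (C := `|u 0| + L * (`|a| + l))) => //.
  exact: lipschitz_measurable L0 uL.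
move=> x Qx; rewrite -[u _](subrK (u 0)) addrC (le_trans (ler_normD _ _)) // lerD //.
rewrite (le_trans (uL _ _)) // subr0 ler_wpM2l //.
exact: cube_norm_le Qx.
Qed.

Lemma integrable_partial_norm a l : 0 < l ->
  mB.-integrable (cube a l) (EFin \o partial_norm).
Proof.
move=> l0; apply: (bounded_integrable_cube l0 measurable_partial_norm) => x _.
by rewrite ger0_norm ?partial_norm_ge0 //; exact: partial_norm_le.
Qed.

Definition cube_int a l : R := \int[mB]_(x in cube a l) u x.
Definition cube_grad a l : R := \int[mB]_(x in cube a l) partial_norm x.

Lemma cube_grad_ge0 a l : 0 <= cube_grad a l.
Proof. by apply: Rintegral_ge0 => x _; exact: partial_norm_ge0. Qed.

Section flips.
Variables (a : 'rV[R]_n) (l : R).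
Hypothesis l0 : 0 < l.
Local Notation I b := (cube_int (subcube_corner a l b) (l / 2)).

Let l20 : 0 < l / 2. Proof. by rewrite divr_gt0. Qed.

(** If [b] and [c] differ at [i], one subcube is the translate of the other by [l / 2] along that
    coordinate, and all intermediate positions lie in the big cube, so [translated_integral_le]
    applies. *)
Lemma cube_int_flip (i : 'I_n) (b c : {ffun 'I_n -> bool}) :
  (forall j, j != i -> b j = c j) -> `|I c - I b| <= l / 2 * cube_grad a l.
Proof.
wlog [bi ci] : b c / b i = false /\ c i = true.
  move=> H bc; have R0 : 0 <= l / 2 * cube_grad a l.
    by rewrite mulr_ge0 ?cube_grad_ge0 // ltW.
  case E : (b i); case F : (c i).
  - rewrite (_ : b = c) ?subrr ?normr0 //; apply/ffunP => j.
    by have [->|/bc//] := eqVneq j i; rewrite E F.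
  - by rewrite distrC; apply: H => // j /bc.
  - exact: H.
  - rewrite (_ : b = c) ?subrr ?normr0 //; apply/ffunP => j.
    by have [->|/bc//] := eqVneq j i; rewrite E F.
move=> bc.
pose E := subcube a l b.
pose e := delta_mx ord0 i : 'rV[R]_n.
have mE : measurable E by exact: measurable_cube.
have Efin : (mB E < +oo)%E.
  exact: borel_lebesgue_cube_fin.
have cE : subcube_corner a l c = subcube_corner a l b + (l / 2) *: e.
  apply/rowP => j; rewrite !mxE eqxx /=.
  have [->|ji] := eqVneq j i; first by rewrite bi ci mul0r mul1r mulr1 addr0.
  by rewrite bc // mulr0 addr0.
have EQ s x : 0 <= s <= l / 2 -> E x -> cube a l (x + s *: e).
  move=> /andP[s0 s2] Ex j; have := subcube_sub l0 Ex j.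
  have := Ex j; rewrite !mxE eqxx /=.
  have [->|ji] := eqVneq j i; last by rewrite mulr0 addr0.
  rewrite bi mul0r mulr1 => /andP[h1 h2] /andP[h3 h4].
  by apply/andP; split; lra.
have mQ : measurable (cube a l) by exact: measurable_cube.
have H := translated_integral_le (i := i) L0 uL mE Efin
  (fun x Ex => cube_norm_le l20 Ex) mQ (ltW l20) EQ.
have U0 : translated_integral u i E 0 = I b.
  by congr fine; apply: eq_integral => x _; rewrite scale0r addr0.
have U1 : translated_integral u i E (l / 2) = I c.
  rewrite /cube_int cE; set f := (l / 2) *: e; congr fine.
  pose D := cube (subcube_corner a l b + f) (l / 2).
  have DE : E = (fun x => x + f) @^-1` D.
    apply/seteqP; split => x Ex j; have := Ex j; rewrite !mxE => /andP[h1 h2];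
      by apply/andP; split; lra.
  rewrite DE -[LHS]/(\int[mB]_(x in _) ((EFin \o u) \o (fun x => x + f)%R) x)%E.
  have mu' := lipschitz_measurable L0 uL.
  rewrite -(integral_pushforward (measurable_translation f)).
  - pose nu : {measure set 'rV[R]_n -> \bar R} :=
      measure_function_pushforward__canonical__measure_function_Measure
      mB (measurable_translation f).
    rewrite -[LHS]/(\int[nu]_(y in D) (u y)%:E)%E.
    by apply: eq_measure_integral => A mA _; exact: borel_lebesgue_translation.
  - exact/measurable_EFinP.
  - rewrite -DE; apply: (bounded_integrable_cube (f := u \o (fun x => x + f))
       (C := `|u 0| + L * (`|subcube_corner a l b + f| + l / 2))) => //.
      by apply: measurableT_comp => //; exact: measurable_translation.
    move=> x Ex /=; rewrite -[u _](subrK (u 0)) addrC.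
    rewrite (le_trans (ler_normD _ _)) // lerD //.
    rewrite (le_trans (uL _ _)) // subr0 ler_wpM2l //.
    apply: (@cube_norm_le _ _ (subcube_corner a l b + f)) => //.
    by rewrite -/D; move: Ex; rewrite -/(subcube a l b) -/E DE.
  - exact: measurable_cube.
rewrite -lee_fin; rewrite U0 U1 in H; apply: (le_trans H).
rewrite [leRHS]EFinM lee_wpmul2l ?lee_fin ?(ltW l20) //.
rewrite /cube_grad /Rintegral fineK; last first.
  by apply: integrable_fin_num => //; exact: integrable_partial_norm.
apply: ge0_le_integral => //.
- apply/measurable_EFinP; apply: measurable_funTS; apply: measurableT_comp => //.
  exact: (measurable_partial L0 uL).
- by apply/measurable_EFinP; apply: measurable_funTS; exact: measurable_partial_norm.
- by move=> x _; rewrite lee_fin partial_le_norm.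
Qed.

(** The coordinates are switched from [b] to [c] one at a time: [m k] agrees with [c] on those below
    [k], and each step is a flip. *)
Lemma cube_int_subcubes (b c : {ffun 'I_n -> bool}) :
  `|I c - I b| <= n%:R * (l / 2 * cube_grad a l).
Proof.
pose m k : {ffun 'I_n -> bool} := [ffun i : 'I_n => if (i < k)%N then c i else b i].
have mS k : (k <= n)%N -> `|I (m k) - I (m 0%N)| <= k%:R * (l / 2 * cube_grad a l).
  elim: k => [|k IH] kn; first by rewrite subrr normr0 mul0r.
  have step : `|I (m k.+1) - I (m k)| <= l / 2 * cube_grad a l.
    apply: (cube_int_flip (i := Ordinal kn)) => j jk; rewrite !ffunE.
    have jk' : (j : nat) != k by [].
    by rewrite (_ : (j < k.+1)%N = (j < k)%N) // ltnS leq_eqVlt (negbTE jk').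
  rewrite -(subrKA (I (m k))) (le_trans (ler_normD _ _)) //.
  by rewrite -[in leRHS](natr1 k) mulrDl mul1r addrC lerD // IH // ltnW.
have -> : c = m n by apply/ffunP => i; rewrite ffunE ltn_ord.
have -> : b = m 0%N by apply/ffunP => i; rewrite ffunE.
exact: mS.
Qed.

Lemma cube_int_split : cube_int a l = \sum_(b : {ffun 'I_n -> bool}) I b.
Proof.
rewrite /cube_int /Rintegral cube_bigcup //.
rewrite (@integral_fin_bigcup _ _ R mB _ (fun b : {ffun 'I_n -> bool} => subcube a l b)).
- rewrite sum_fine // => b _.
  by apply: integrable_fin_num; [exact: measurable_cube|exact: integrable_lipschitz_cube].
- by move=> b; exact: measurable_cube.
- exact: trivIset_subcube.
- by apply: measurable_funTS; exact: lipschitz_measurable L0 uL.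
Qed.

(** The average over the cube is the mean of those over its 2^n subcubes, so the difference is
    l^(-n) times a sum of 2^n terms [I b - I c], each at most n l [cube_grad a l]. Hence the factor
    n 2^n. *)
Lemma average_subcube (b : {ffun 'I_n -> bool}) :
  `|(l / 2) ^- n * I b - l ^- n * cube_int a l| <=
  n%:R * 2 ^+ n * (l * (cube_grad a l / l ^+ n)).
Proof.
have l0' : l != 0 by rewrite gt_eqF.
have -> : (l / 2) ^- n * I b - l ^- n * cube_int a l =
    l ^- n * \sum_(c : {ffun 'I_n -> bool}) (I b - I c).
  rewrite sumrB sumr_const card_ffun card_bool card_ord -cube_int_split mulrBr.
  congr (_ - _); rewrite -[_ *+ (2 ^ n)]mulr_natl natrX mulrA; congr (_ * _).
  by rewrite expr_div_n invf_div mulrC.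
rewrite normrM ger0_norm ?invr_ge0 ?exprn_ge0 ?(ltW l0) //.
rewrite (_ : n%:R * _ * _ = l ^- n * \sum_(c : {ffun 'I_n -> bool})
    (n%:R * (l * cube_grad a l))); last first.
  rewrite sumr_const card_ffun card_bool card_ord -[_ *+ (2 ^ n)]mulr_natl natrX.
  by rewrite /=; ring.
rewrite ler_wpM2l ?invr_ge0 ?exprn_ge0 ?(ltW l0) //.
apply: (le_trans (ler_norm_sum _ _ _)); apply: ler_sum => c _.
apply: (le_trans (cube_int_subcubes c b)).
rewrite ler_wpM2l // ler_wpM2r ?cube_grad_ge0 //.
by rewrite ler_pdivrMr // ler_peMr ?(ltW l0) // ler1n.
Qed.

End flips.
End oscillation.

Section real_integrands.
Context d (T : measurableType d) (R : realType) (m : {measure set T -> \bar R}).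
Variable (D : set T).
Hypothesis mD : measurable D.
Implicit Types (f g : T -> R) (k : R).

Lemma nneg_integralZl f k : measurable_fun D f -> (forall x, 0 <= f x) ->
  0 <= k ->
  (\int[m]_(x in D) (k * f x)%:E = k%:E * \int[m]_(x in D) (f x)%:E)%E.
Proof.
move=> mf f0 k0; rewrite -ge0_integralZl //.
  exact/measurable_EFinP.
by move=> x _; rewrite lee_fin.
Qed.

Lemma nneg_integralD f g : measurable_fun D f -> measurable_fun D g ->
  (forall x, 0 <= f x) -> (forall x, 0 <= g x) ->
  (\int[m]_(x in D) (f x + g x)%:E =
   \int[m]_(x in D) (f x)%:E + \int[m]_(x in D) (g x)%:E)%E.
Proof.
move=> mf mg f0 g0; rewrite -ge0_integralD //.
- by move=> x _; rewrite lee_fin.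
- exact/measurable_EFinP.
- by move=> x _; rewrite lee_fin.
- exact/measurable_EFinP.
Qed.

Lemma nneg_ae_le_integral f g : measurable_fun D f -> measurable_fun D g ->
  (forall x, 0 <= f x) -> (forall x, 0 <= g x) ->
  {ae m, forall x, D x -> f x <= g x} ->
  (\int[m]_(x in D) (f x)%:E <= \int[m]_(x in D) (g x)%:E)%E.
Proof.
move=> mf mg f0 g0 fg; apply: ae_ge0_le_integral => //.
- by move=> x _; rewrite lee_fin.
- exact/measurable_EFinP.
- by move=> x _; rewrite lee_fin.
- exact/measurable_EFinP.
Qed.

Lemma nneg_subset_integral (E : set T) f : measurable E -> E `<=` D ->
  measurable_fun D f -> (forall x, 0 <= f x) ->
  (\int[m]_(x in E) (f x)%:E <= \int[m]_(x in D) (f x)%:E)%E.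
Proof.
move=> mE ED mf f0; apply: ge0_subset_integral => //.
  exact/measurable_EFinP.
by move=> x _; rewrite lee_fin.
Qed.

Lemma ae_eq_integral_EFin f g : measurable_fun D f -> measurable_fun D g ->
  {ae m, forall x, D x -> f x = g x} ->
  (\int[m]_(x in D) (f x)%:E = \int[m]_(x in D) (g x)%:E)%E.
Proof.
move=> mf mg fg; apply: ae_eq_integral => //; [exact/measurable_EFinP..|].
by move: fg; apply: filterS => x /[apply] ->.
Qed.

Lemma measurable_fun_norm f : measurable_fun D f ->
  measurable_fun D (fun x => `|f x|).
Proof. exact: measurableT_comp. Qed.
End real_integrands.

(** * Dyadic cubes indexed by words *)

Section dyadic_words.
Variables (R : realType) (n : nat) (a0 : 'rV[R]_n) (l0 : R).
Hypothesis l0_gt0 : 0 < l0.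
Local Notation mu := (lebesgue_rV R n).
Local Notation LT := (lebesgue_type R n).
Local Notation B := {ffun 'I_n -> bool}.
Implicit Types (s : seq B) (k : nat) (P : pred (seq B)).

Fixpoint word_side s : R := if s is _ :: s' then word_side s' / 2 else l0.

Fixpoint word_corner s : 'rV[R]_n :=
  if s is b :: s' then subcube_corner (word_corner s') (word_side s') b else a0.

Definition word_cube s := cube (word_corner s) (word_side s).

Lemma word_side_gt0 s : 0 < word_side s.
Proof. by elim: s => //= b s IH; rewrite divr_gt0. Qed.

Lemma dyadic_word_cube s : dyadic (cube a0 l0) (word_cube s).
Proof.
elim: s => [|b s IH]; first exact: dyadic_root.
exact: dyadic_child (word_side_gt0 s) IH.
Qed.

Lemma word_cube_cons b s : word_cube (b :: s) `<=` word_cube s.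
Proof. exact: subcube_sub (word_side_gt0 s). Qed.

Lemma word_cube_sub s : word_cube s `<=` cube a0 l0.
Proof.
elim: s => [//|b s IH]; apply: subset_trans IH; exact: word_cube_cons.
Qed.

Lemma word_cubeE s : word_cube s = \bigcup_b word_cube (b :: s).
Proof. exact: cube_bigcup (word_side_gt0 s). Qed.

Lemma measurable_word_cube s : measurable (word_cube s : set LT).
Proof. by apply: borel_lebesgue_measurable; exact: measurable_cube. Qed.

Lemma lebesgue_word_cube s : mu (word_cube s) = (word_side s ^+ n)%:E.
Proof. by rewrite lebesgue_rV_cube // word_side_gt0. Qed.

(* The union of the maximal stopping cubes at most [k] generations below [s]. *)
Fixpoint stop_set P k s : set 'rV[R]_n :=
  if k is k'.+1 then
    \bigcup_b (if P (b :: s) then word_cube (b :: s) else stop_set P k' (b :: s))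
  else set0.

Lemma measurable_stop_set P k s : measurable (stop_set P k s : set LT).
Proof.
elim: k s => [|k IH] s /=; first exact: measurable0.
apply: fin_bigcup_measurable; first exact: finite_finset.
by move=> b _; case: ifP => _; [exact: measurable_word_cube|exact: IH].
Qed.

Lemma stop_set_sub P k s : stop_set P k s `<=` word_cube s.
Proof.
elim: k s => [|k IH] s //= x [b _].
by case: ifP => _ bx; apply: (@word_cube_cons b) => //; exact: IH bx.
Qed.

Section integrals.
Variable f : 'rV[R]_n -> R.
Hypotheses (f0 : forall x, 0 <= f x)
  (mf : measurable_fun (cube a0 l0 : set LT) (f : LT -> R))
  (ffin : (\int[mu]_(x in cube a0 l0) (f x)%:E < +oo)%E).

Definition word_int s : R := fine (\int[mu]_(x in word_cube s) (f x)%:E)%E.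

Lemma integral_sub_fin (E : set 'rV[R]_n) : measurable (E : set LT) ->
  E `<=` cube a0 l0 -> (\int[mu]_(x in E) (f x)%:E)%E \is a fin_num.
Proof.
move=> mE EQ; rewrite ge0_fin_numE; last first.
  by apply: integral_ge0 => x _; rewrite lee_fin.
apply: le_lt_trans ffin; apply: nneg_subset_integral => //.
exact: (measurable_word_cube [::]).
Qed.

Lemma word_intE s : ((word_int s)%:E = \int[mu]_(x in word_cube s) (f x)%:E)%E.
Proof.
rewrite fineK //; apply: integral_sub_fin; first exact: measurable_word_cube.
exact: word_cube_sub.
Qed.

Lemma word_int_ge0 s : 0 <= word_int s.
Proof. by apply: fine_ge0; apply: integral_ge0 => x _; rewrite lee_fin. Qed.

Let children_additive s (F : B -> set 'rV[R]_n) :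
  (forall b, measurable (F b : set LT)) ->
  (forall b, F b `<=` word_cube (b :: s)) ->
  fine (\int[mu]_(x in \bigcup_b F b) (f x)%:E)%E =
  \sum_b fine (\int[mu]_(x in F b) (f x)%:E)%E.
Proof.
move=> mF FQ.
have FQ0 b : F b `<=` cube a0 l0.
  by apply: subset_trans (FQ b) _; exact: word_cube_sub.
rewrite (@integral_fin_bigcup _ LT R mu B F) //.
- by rewrite sum_fine // => b _; exact: integral_sub_fin.
- move=> b c _ _ [x [bx cx]]; apply: (subcube_disjoint (word_side_gt0 s)).
  by exists x; split; apply: FQ.
- apply: measurable_funS mf; first exact: (measurable_word_cube [::]).
  by apply: bigcup_sub.
Qed.

Lemma word_int_additive : tree_additive word_int.
Proof.
move=> s; rewrite /word_int word_cubeE; apply: children_additive => b.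
  exact: measurable_word_cube.
exact: subset_refl.
Qed.

(** Turns the combinatorial mass into an integral over an actual set, to which the [A_infty]
    condition applies. *)
Lemma stop_mass_word_int P k s :
  stop_mass P word_int k s = fine (\int[mu]_(x in stop_set P k s) (f x)%:E)%E.
Proof.
elim: k s => [|k IH] s /=; first by rewrite integral_set0.
rewrite (children_additive (s := s)).
- by apply: eq_bigr => b _; case: ifP.
- move=> b; case: ifP => _; first exact: measurable_word_cube.
  exact: measurable_stop_set.
- by move=> b; case: ifP => _ //; exact: stop_set_sub.
Qed.
End integrals.
End dyadic_words.

(** * Sparseness of principal cubes for [A_infty] weights *)

Section Ainfty_stopping.
Variables (R : realType) (n : nat) (a0 : 'rV[R]_n) (l0 : R).
Hypothesis l0_gt0 : 0 < l0.
Local Notation mu := (lebesgue_rV R n).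
Local Notation LT := (lebesgue_type R n).
Local Notation B := {ffun 'I_n -> bool}.
Local Notation Qs := (@word_cube R n a0 l0).
Local Notation side := (@word_side R n l0).
Local Notation word_vol := (fun s : seq B => side s ^+ n).
Implicit Types (s : seq B) (k : nat) (P : pred (seq B)).

Lemma word_volE : word_vol = word_int a0 l0 (cst 1).
Proof.
apply/funext => s; rewrite /word_int.
have := integral_cst mu (measurable_word_cube a0 l0 s) 1.
by rewrite mul1e /= => ->; rewrite lebesgue_word_cube.
Qed.

Lemma word_vol_gt0 s : 0 < word_vol s.
Proof. by rewrite exprn_gt0 // word_side_gt0. Qed.

Lemma lebesgue_stop_set P k s :
  mu (stop_set a0 l0 P k s) = (stop_mass P word_vol k s)%:E.
Proof.
have m1 : measurable_fun (cube a0 l0 : set LT) (cst 1 : LT -> R).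
  exact: measurable_cst.
have cub : (\int[mu]_(x in cube a0 l0) (cst 1 x : R)%:E = (l0 ^+ n)%:E)%E.
  have := integral_cst mu (measurable_word_cube a0 l0 [::]) 1.
  by rewrite mul1e /= => ->; rewrite lebesgue_rV_cube.
rewrite word_volE stop_mass_word_int //; last by rewrite cub ltry.
have mS := measurable_stop_set a0 l0 P k s.
rewrite fineK.
  by have := integral_cst mu mS 1; rewrite mul1e.
apply: (integral_sub_fin (a0 := a0) (l0 := l0)) => //.
  by rewrite cub ltry.
by apply: subset_trans (@stop_set_sub _ _ _ _ _ _ _ _) _ => //; exact: word_cube_sub.
Qed.

Variables (f : 'rV[R]_n -> R) (C delta : R).
Hypotheses (f0 : forall x, 0 <= f x)
  (mf : measurable_fun (cube a0 l0 : set LT) (f : LT -> R))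
  (ffin : (\int[mu]_(x in cube a0 l0) (f x)%:E < +oo)%E)
  (fgt0 : forall s, 0 < word_int a0 l0 f s) (C0 : 0 < C) (d0 : 0 < delta)
  (Af : forall s E, measurable (E : set LT) -> E `<=` Qs s ->
    (\int[mu]_(x in E) (f x)%:E / \int[mu]_(x in Qs s) (f x)%:E <=
     C%:E * (mu E / mu (Qs s)) `^ delta)%E).

Lemma stop_mass_Ainfty P k s :
  stop_mass P (word_int a0 l0 f) k s <=
  C * (stop_mass P word_vol k s / word_vol s) `^ delta * word_int a0 l0 f s.
Proof.
have mS := measurable_stop_set a0 l0 P k s.
have SQ := stop_set_sub (a0 := a0) l0_gt0 (P := P) (k := k) (s := s).
have := Af mS SQ.
rewrite lebesgue_stop_set lebesgue_word_cube // -(word_intE l0_gt0 f0 mf ffin).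
rewrite -[(\int[mu]_(x in stop_set _ _ _ _ _) _)%E]fineK; last first.
  apply: (integral_sub_fin f0 mf ffin) => //.
  by apply: subset_trans SQ _; exact: word_cube_sub.
rewrite -stop_mass_word_int // !inver (gt_eqF (fgt0 s)) (gt_eqF (word_vol_gt0 s)).
rewrite -!EFinM lee_fin; by rewrite ler_pdivrMr.
Qed.

(** The principal cubes just below [s] fill at most the fraction 1/A of its volume, hence by
    [A_infty] at most the fraction C A^(-delta) of its weight. The lower bound on [A] is C
    A^(-delta) <= e solved for [A]. *)
Lemma stop_mass_principal_Ainfty (A e : R) (G : seq B -> R) k s :
  1 <= A -> 0 < e -> (C / e) `^ delta^-1 <= A ->
  (forall s, 0 <= G s) -> tree_additive G -> principal A G word_vol s ->
  stop_mass (principal A G word_vol) (word_int a0 l0 f) k s <=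
  e * word_int a0 l0 f s.
Proof.
move=> A1 e0 CA G0 aG Ps; apply: (le_trans (stop_mass_Ainfty _ k s)).
rewrite ler_wpM2r ?(ltW (fgt0 s)) //.
have A0 : 0 < A by exact: lt_le_trans A1.
have H := stop_mass_principal A1 G0 word_vol_gt0 aG k Ps.
apply: (@le_trans _ _ (C * A^-1 `^ delta)).
  rewrite ler_wpM2l ?(ltW C0) //; apply: ler_powR2r; first exact: ltW.
    by rewrite divr_ge0 ?(ltW (word_vol_gt0 s)) // -lee_fin -(lebesgue_stop_set) measure_ge0.
  by rewrite ler_pdivrMr // word_vol_gt0.
rewrite -powR_inv1 ?(ltW A0) // -powRrM mulN1r powRN ler_pdivrMr ?powR_gt0 //.
rewrite mulrC -ler_pdivrMr //.
have -> : C / e = ((C / e) `^ delta^-1) `^ delta.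
  by rewrite -powRrM mulVf ?gt_eqF // powRr1 // divr_ge0 ?(ltW C0) ?(ltW e0).
by apply: ler_powR2r => //; [exact: ltW|exact: powR_ge0].
Qed.
End Ainfty_stopping.

(** * From finite trees to the integral over the cube *)

Section dyadic_approximation.
Variables (R : realType) (n : nat) (u : 'rV[R]_n -> R) (L : R).
Hypotheses (L0 : 0 <= L) (uL : forall x y, `|u x - u y| <= L * `|x - y|).
Local Notation mu := (lebesgue_rV R n).
Local Notation mB := (borel_lebesgue R n).
Local Notation LT := (lebesgue_type R n).
Local Notation B := {ffun 'I_n -> bool}.

Lemma cube_average_close a l x : 0 < l -> cube a l x ->
  `|u x - l ^- n * cube_int u a l| <= L * l.
Proof.
move=> l0 Qx; have ln0 : 0 < l ^+ n by rewrite exprn_gt0.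
have iu := integrable_lipschitz_cube L0 uL a l0.
have icst c : mB.-integrable (cube a l) (EFin \o (cst c : 'rV[R]_n -> R)).
  by apply: (bounded_integrable_cube (C := `|c|)) => //; exact: measurable_cst.
have vol : fine (mB (cube a l)) = l ^+ n by rewrite borel_lebesgue_cube.
have mQ : measurable (cube a l) by exact: measurable_cube.
have uxy y : cube a l y -> `|u x - u y| <= L * l.
  by move=> Qy; rewrite (le_trans (uL _ _)) // ler_wpM2l // (cube_diam_le l0 Qx).
have h1 : cube_int u a l <= (u x + L * l) * l ^+ n.
  rewrite -vol -Rintegral_cst //; apply: (le_Rintegral mQ iu (icst _)) => y Qy.
  have := uxy y Qy; rewrite ler_norml => /andP[h h'].
  by have H : u y <= u x + L * l by lra; exact: H.
have h2 : (u x - L * l) * l ^+ n <= cube_int u a l.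
  rewrite -vol -Rintegral_cst //; apply: (le_Rintegral mQ (icst _) iu) => y Qy.
  have := uxy y Qy; rewrite ler_norml => /andP[h h'].
  by have H : u x - L * l <= u y by lra; exact: H.
rewrite distrC ler_distl; apply/andP; split.
  by rewrite ler_pdivlMl // mulrC.
by rewrite ler_pdivrMl // mulrC.
Qed.

Variables (a0 : 'rV[R]_n) (l0 : R) (f : 'rV[R]_n -> R) (q : R).
Hypotheses (l0_gt0 : 0 < l0) (f0 : forall x, 0 <= f x)
  (mf : measurable_fun (cube a0 l0 : set LT) (f : LT -> R))
  (ffin : (\int[mu]_(x in cube a0 l0) (f x)%:E < +oo)%E)
  (q1 : 1 <= q).
Local Notation Qs := (@word_cube R n a0 l0).
Local Notation side := (@word_side R n l0).

Definition word_average (s : seq B) : R :=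
  side s ^- n * cube_int u (word_corner a0 l0 s) (side s).

Let mint c : measurable_fun (cube a0 l0 : set LT)
  (fun x : LT => `|u x - c| `^ q * f x).
Proof.
apply: measurable_funM; last exact: mf.
apply: (@measurable_fun_completion R n _ _ (fun x => `|u x - c| `^ q)).
apply: (@measurableT_comp _ _ _ _ _ _ (fun t => t `^ q)); first exact: measurable_powR.
apply: measurableT_comp => //; apply: measurable_funB => //.
exact: lipschitz_measurable L0 uL.
Qed.

Let q0 : 0 <= q. Proof. exact: le_trans ler01 q1. Qed.

(** On a leaf [u] differs from its average by at most [L] times the side. This error is kept as a
    separate summand, which vanishes as the depth grows. *)
Lemma integral_le_leaf_sum c k s :
  (\int[mu]_(x in Qs s) (`|u x - c| `^ q * f x)%:E <=
   (leaf_sum (fun t => 2 `^ q * (`|word_average t - c| `^ q + (L * side t) `^ q) *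
      word_int a0 l0 f t) k s)%:E)%E.
Proof.
elim: k s => [|k IH] s /=.
  have mQs := measurable_word_cube a0 l0 s.
  set K := 2 `^ q * _.
  have K0 : 0 <= K by rewrite mulr_ge0 ?addr_ge0 ?powR_ge0.
  rewrite EFinM (word_intE l0_gt0 f0 mf ffin).
  have QsQ : Qs s `<=` cube a0 l0 by exact: word_cube_sub.
  have mfs : measurable_fun (Qs s : set LT) (f : LT -> R).
    by apply: measurable_funS mf => //; exact: (measurable_word_cube a0 l0 [::]).
  rewrite -(nneg_integralZl mu mQs mfs f0 K0).
  apply: (nneg_ae_le_integral mQs).
  - apply: measurable_funS (mint c); last exact: QsQ.
    exact: (measurable_word_cube a0 l0 [::]).
  - by apply: measurable_funM; [exact: measurable_cst|exact: mfs].
  - by move=> x; rewrite mulr_ge0 // powR_ge0.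
  - by move=> x; rewrite mulr_ge0.
  - apply: aeW => x Qx; rewrite ler_wpM2r // /K.
    apply: le_trans (powRD_le q0 _ _); last 2 first.
      by [].
      by rewrite mulr_ge0 // ltW // word_side_gt0.
    apply: ler_powR2r => //; rewrite [leRHS]addrC.
    rewrite -(subrKA (word_average s)) (le_trans (ler_normD _ _)) // lerD //.
    by apply: cube_average_close => //; exact: word_side_gt0.
rewrite {1}word_cubeE // (@integral_fin_bigcup _ LT R mu B (fun b => Qs (b :: s))).
- by rewrite -sumEFin; apply: lee_sum => b _; exact: IH.
- by move=> b; exact: measurable_word_cube.
- by move=> b d _ _; exact: subcube_disjoint (word_side_gt0 l0_gt0 s).
- apply: measurable_funS (mint c); first exact: (measurable_word_cube a0 l0 [::]).
  by apply: bigcup_sub => b _; exact: word_cube_sub.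
Qed.

Let leaf_sum_error k s :
  leaf_sum (fun t => (L * side t) `^ q * word_int a0 l0 f t) k s =
  (L * (side s / 2 ^+ k)) `^ q * word_int a0 l0 f s.
Proof.
elim: k s => [|k IH] s /=; first by rewrite expr0 divr1.
rewrite [in RHS](word_int_additive l0_gt0 f0 mf ffin s) mulr_sumr.
apply: eq_bigr => b _; rewrite IH /=.
by rewrite (_ : side s / 2 ^+ k.+1 = side s / 2 / 2 ^+ k) // exprS invfM mulrA.
Qed.

Let leaf_sumD (h1 h2 : seq B -> R) k s :
  leaf_sum (fun t => h1 t + h2 t) k s = leaf_sum h1 k s + leaf_sum h2 k s.
Proof.
elim: k s => [|k IH] s //=; rewrite -big_split /=.
by apply: eq_bigr => b _; exact: IH.
Qed.

Let small_error (e : R) : 0 < e -> exists k : nat,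
  2 `^ q * ((L * (l0 / 2 ^+ k)) `^ q * word_int a0 l0 f [::]) <= e.
Proof.
move=> e0; set W := word_int a0 l0 f [::].
have W0 : 0 <= W by exact: word_int_ge0.
have th0 : 0 < (2 : R) `^ q by rewrite powR_gt0.
(* The bound by 1 gives eta^q <= eta, as q >= 1, so that no root of [e] has to be taken. *)
pose eta := Order.min 1 (e / (2 `^ q * (W + 1))).
have W1 : 0 < W + 1 by lra.
have eta0 : 0 < eta by rewrite lt_min ltr01 divr_gt0 // mulr_gt0.
have [k kP] : exists k : nat, L * (l0 / 2 ^+ k) <= eta.
  exists (Num.bound (L * l0 / eta)).
  set k := Num.bound _.
  have : L * l0 / eta < k%:R.
    by rewrite archi_boundP // divr_ge0 ?mulr_ge0 // ltW.
  have k2 : (k%:R : R) <= 2 ^+ k by rewrite -natrX ler_nat ltnW // ltn_expl.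
  move=> /ltW /le_trans /(_ k2); rewrite ler_pdivrMr // (mulrC _ eta) => H.
  by rewrite mulrA ler_pdivrMr ?exprn_gt0.
exists k.
have H : (L * (l0 / 2 ^+ k)) `^ q <= e / (2 `^ q * (W + 1)).
  apply: (@le_trans _ _ (eta `^ q)).
    by apply: ler_powR2r => //; rewrite !mulr_ge0 // ?invr_ge0 ?exprn_ge0 // ltW.
  apply: (@le_trans _ _ eta); last by rewrite ge_min lexx orbT.
  by apply: ge1r_powR => //; rewrite eta0 ge_min lexx.
rewrite mulrCA; apply: (le_trans (ler_wpM2r _ H)).
  by rewrite mulr_ge0 // ltW.
rewrite mulrAC ler_pdivrMr ?mulr_gt0 // ler_pM2l // ler_pM2l //.
by rewrite lerDl.
Qed.

Lemma integral_le_of_leaf_sums c (M : R) :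
  (forall k, leaf_sum (fun t => `|word_average t - c| `^ q * word_int a0 l0 f t)
     k [::] <= M) ->
  (\int[mu]_(x in cube a0 l0) (`|u x - c| `^ q * f x)%:E <= (2 `^ q * M)%:E)%E.
Proof.
move=> HM; apply/lee_addgt0Pr => e e0.
have [k kP] := small_error e0.
apply: (le_trans (integral_le_leaf_sum c k [::])).
rewrite -EFinD lee_fin.
rewrite (_ : (fun t => _) = (fun t => 2 `^ q * (`|word_average t - c| `^ q *
   word_int a0 l0 f t + (L * side t) `^ q * word_int a0 l0 f t))); last first.
  by apply/funext => t; rewrite -mulrDl mulrA.
rewrite leaf_sumZ leaf_sumD leaf_sum_error mulrDr lerD //.
by rewrite ler_wpM2l ?powR_ge0.
Qed.
End dyadic_approximation.

(** * The weighted inequality *)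

(** McShane's extension: the infimum of u(y) + L |x - y| over y in [Q]. *)
Lemma lipschitz_extension (R : realType) (V : normedModType R) (Q : set V)
    (u : V -> R) : [lipschitz u x | x in Q] -> Q !=set0 ->
  exists (L : R) (f : V -> R), [/\ 0 <= L,
    forall x y, `|f x - f y| <= L * `|x - y| & forall x, Q x -> f x = u x].
Proof.
move=> uQ [z Qz].
have [L L0 uL] : exists2 L : R, 0 <= L &
    forall x y, Q x -> Q y -> `|u x - u y| <= L * `|x - y|.
  have [M M0 uM] := pinfty_ex_gt0 uQ.
  by exists M; [exact: ltW|move=> x y Qx Qy; exact: (uM (x, y))].
pose S x := [set u y + L * `|x - y| | y in Q].
pose f x := inf (S x).
have Slb x y : Q y -> u y - L * `|x - y| <= f x.
  move=> Qy; apply: lb_le_inf; first by exists (u z + L * `|x - z|); exists z.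
  move=> _ [y' Qy' <-]; have := uL y y' Qy Qy'.
  have : L * `|y - y'| <= L * (`|x - y| + `|x - y'|).
    by rewrite ler_wpM2l // (distrC x) ler_distD.
  by rewrite mulrDr ler_norml => h /andP[h1 h2]; lra.
have Slinf x : has_inf (S x).
  split; first by exists (u z + L * `|x - z|); exists z.
  exists (u z - L * `|x - z|) => _ [y' Qy' <-].
  have := uL z y' Qz Qy'.
  have : L * `|z - y'| <= L * (`|x - z| + `|x - y'|).
    by rewrite ler_wpM2l // (distrC x) ler_distD.
  by rewrite mulrDr ler_norml => h /andP[h1 h2]; lra.
have fle x y : Q y -> f x <= u y + L * `|x - y|.
  by move=> Qy; apply: ge_inf; [have [_] := Slinf x|exists y].
have fL x y : f x - f y <= L * `|x - y|.
  rewrite lerBlDr addrC -lerBlDr; apply: lb_le_inf.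
    by exists (u z + L * `|y - z|); exists z.
  move=> _ [y' Qy' <-]; have := fle x y' Qy'.
  have : L * `|x - y'| <= L * (`|x - y| + `|y - y'|).
    by rewrite ler_wpM2l // ler_distD.
  by rewrite mulrDr => h1 h2; lra.
exists L, f; split => // [x y|x Qx].
  have := fL x y; have := fL y x; rewrite (distrC y) => h1 h2.
  by rewrite ler_norml; apply/andP; split; lra.
have := fle x x Qx; have := Slb x x Qx; rewrite subrr normr0 mulr0 subr0 addr0.
by move=> h1 h2; apply/eqP; rewrite eq_le h1 h2.
Qed.

(** By completeness of the measure. It serves the integrand with [gradient u], known only to agree
    almost everywhere with a measurable function. *)
Lemma measurable_fun_ae_eq (R : realType) n (D N : set 'rV[R]_n)
    (f h : 'rV[R]_n -> R) :
  measurable (D : set (lebesgue_type R n)) ->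
  measurable_fun (D : set (lebesgue_type R n)) (h : lebesgue_type R n -> R) ->
  (lebesgue_rV R n).-negligible N ->
  (forall x, D x -> ~ N x -> f x = h x) ->
  measurable_fun (D : set (lebesgue_type R n)) (f : lebesgue_type R n -> R).
Proof.
move=> mD mh [N' [mN' N'0 NN']] fh _ Y mY.
have cmpl := @measure_is_complete_caratheodory R _ (borel_lebesgue R n)^*%mu.
have -> : D `&` f @^-1` Y =
    ((D `&` h @^-1` Y) `\` N') `|` (D `&` f @^-1` Y `&` N').
  apply/seteqP; split => x.
    move=> [Dx Yx]; have [N'x|N'x] := pselect (N' x); first by right.
    by left; split => //; split => //=; rewrite -fh // => /NN'.
  move=> [[[Dx Yx] N'x]|[//]]; split => //=.
  by rewrite fh // => /NN'.
apply: measurableU; first by apply: measurableD => //; exact: mh.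
by apply: cmpl; exists N'; split => // x [].
Qed.

(** For a cube of side [l] the factor of the testing condition is l / l^n. Raise the condition to
    the power q/p and multiply by G^q s^((1-p)q/p), the power of the perspective; the powers of [s]
    cancel. *)
Lemma testing_powR (R : realType) (n : nat) (p q K l w s G : R) :
  (0 < n)%N -> 1 < p -> p <= q -> 0 < l -> 0 < w -> 0 < s -> 0 <= G ->
  ((l ^+ n) `^ (1 - n%:R^-1))^-1 `^ p * w `^ (p / q) * s `^ (p - 1) <= K ->
  (l * (G / l ^+ n)) `^ q * w <= K `^ (q / p) * perspective p G s `^ (q / p).
Proof.
move=> n0 p1 pq l0 w0 s0 G0.
have p0 : 0 < p by lra.
have q0 : 0 < q by lra.
have n0' : (n%:R : R) != 0 by rewrite pnatr_eq0 -lt0n.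
have ln0 : 0 < l ^+ n by rewrite exprn_gt0.
have -> : ((l ^+ n) `^ (1 - n%:R^-1))^-1 = l / l ^+ n.
  rewrite powRB; last by rewrite (gt_eqF ln0) implybT.
  rewrite powRr1 ?(ltW ln0) // invf_div; congr (_ / _).
  by rewrite -powR_mulrn ?(ltW l0) // -powRrM divff // powRr1 // ltW.
set X := l / l ^+ n; have X0 : 0 < X by rewrite divr_gt0.
set r := q / p; have r0 : 0 < r by rewrite divr_gt0.
have pr : p * r = q by rewrite /r mulrC divfK // gt_eqF.
move=> /(ler_powR2r (ltW r0)) HK.
have {}HK : X `^ q * w * s `^ ((p - 1) * r) <= K `^ r.
  apply: le_trans (HK _); last by rewrite !mulr_ge0 ?powR_ge0.
  rewrite [leRHS](powRM r (mulr_ge0 (powR_ge0 _ _) (powR_ge0 _ _)) (powR_ge0 _ _)).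
  rewrite (powRM r (powR_ge0 _ _) (powR_ge0 _ _)).
  rewrite -[X `^ p `^ r]powRrM -[w `^ _ `^ r]powRrM -[s `^ _ `^ r]powRrM pr.
  rewrite (_ : p / q * r = 1) ?powRr1 ?(ltW w0) //.
  by rewrite /r; field; rewrite !gt_eqF.
apply: le_trans (ler_wpM2r (powR_ge0 _ _) HK).
rewrite /perspective (powRM r (powR_ge0 _ _) (powR_ge0 _ _)) -!powRrM pr.
rewrite mulrCA -/X (powRM q G0 (ltW X0)).
rewrite -!mulrA (mulrCA (s `^ _)) -powRD; last by rewrite (gt_eqF s0) implybT.
rewrite (_ : (p - 1) * r + (1 - p) * r = 0); last by ring.
by rewrite powRr0 mulr1 mulrCA [w * _]mulrC.
Qed.

(** The thresholds of [stop_mass_principal_Ainfty] for the fractions 1/(2 2^q) with [w] and 1/2 with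
    sigma. *)
Definition stop_factor (R : realType) (q Cw Cs dw ds : R) : R :=
  Num.max 1 (Num.max ((Cw / (2 * 2 `^ q)^-1) `^ dw^-1) ((Cs / 2^-1) `^ ds^-1)).

(** The q-th power of the final constant. The outer 2^q comes from replacing [u] by its averages on
    leaves, n 2^n from [average_subcube], the inner 2^q from [principal_sum_powR_le], the last 2
    from [leaf_sum_weighted_le], and the rest from testing and Carleson. *)
Definition poincare_constant (R : realType) (n : nat)
    (p q K Cw Cs dw ds : R) : R :=
  2 `^ q * ((2 * (n%:R * 2 ^+ n) * stop_factor q Cw Cs dw ds) `^ q *
    (2 `^ q * (2 * (K `^ (q / p) * carleson_constant p `^ (q / p))))).

Section core.
Variables (R : realType) (n : nat) (p q K Cw Cs dw ds : R).
Hypotheses (n0 : (0 < n)%N) (p1 : 1 < p) (pq : p <= q) (K0 : 0 < K).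
Hypotheses (Cw0 : 0 < Cw) (Cs0 : 0 < Cs) (dw0 : 0 < dw) (ds0 : 0 < ds).
Variables (u : 'rV[R]_n -> R) (L : R).
Hypotheses (L0 : 0 <= L) (uL : forall x y, `|u x - u y| <= L * `|x - y|).
Variables (a0 : 'rV[R]_n) (l0 : R).
Hypothesis l0_gt0 : 0 < l0.
Local Notation mu := (lebesgue_rV R n).
Local Notation LT := (lebesgue_type R n).
Local Notation B := {ffun 'I_n -> bool}.
Local Notation Q0 := (cube a0 l0 : set LT).
Local Notation Qs := (@word_cube R n a0 l0).
Local Notation side := (@word_side R n l0).
Local Notation word_vol := (fun s : seq B => side s ^+ n).
Local Notation wint := (@word_int R n a0 l0).
(** [W] and [S] stand for the two weights [w] and sigma, [H] for |grad u|^p v. All are nonnegative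
    everywhere, so that the tree sums involve no exceptional set. *)
Variables (W S H : 'rV[R]_n -> R).
Hypotheses (W0 : forall x, 0 <= W x) (S0 : forall x, 0 <= S x)
  (H0 : forall x, 0 <= H x).
Hypotheses (mW : measurable_fun Q0 (W : LT -> R))
  (mS : measurable_fun Q0 (S : LT -> R)) (mH : measurable_fun Q0 (H : LT -> R)).
Hypotheses (Wfin : (\int[mu]_(x in Q0) (W x)%:E < +oo)%E)
  (Sfin : (\int[mu]_(x in Q0) (S x)%:E < +oo)%E)
  (Hfin : (\int[mu]_(x in Q0) (H x)%:E < +oo)%E).
Hypotheses (Wgt0 : forall s, 0 < wint W s) (Sgt0 : forall s, 0 < wint S s).
Hypotheses (AW : forall s (E : set LT), measurable E -> E `<=` Qs s ->
    (\int[mu]_(x in E) (W x)%:E / \int[mu]_(x in Qs s) (W x)%:E <=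
     Cw%:E * (mu E / mu (Qs s)) `^ dw)%E)
  (AS : forall s (E : set LT), measurable E -> E `<=` Qs s ->
    (\int[mu]_(x in E) (S x)%:E / \int[mu]_(x in Qs s) (S x)%:E <=
     Cs%:E * (mu E / mu (Qs s)) `^ ds)%E).
Hypothesis test : forall s, ((word_vol s) `^ (1 - n%:R^-1))^-1 `^ p *
  wint W s `^ (p / q) * wint S s `^ (p - 1) <= K.
Hypothesis HS : {ae mu, forall x, Q0 x ->
  0 < S x /\ H x = perspective p (partial_norm u x) (S x)}.

Let g := partial_norm u.

Let mg : measurable_fun Q0 (g : LT -> R).
Proof. apply: measurable_fun_completion; exact: measurable_partial_norm L0 uL. Qed.

Let g0 x : 0 <= g x. Proof. exact: partial_norm_ge0. Qed.

Let gint s : (\int[mu]_(x in Qs s) (g x)%:E =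
  (cube_grad u (word_corner a0 l0 s) (side s))%:E)%E.
Proof.
have mQ : measurable (Qs s : set 'rV[R]_n) by exact: measurable_cube.
rewrite /cube_grad /Rintegral fineK.
  apply: ge0_integral_lebesgue_rV => //.
    by apply/measurable_EFinP; exact: measurable_partial_norm L0 uL.
apply: integrable_fin_num => //.
exact: (integrable_partial_norm L0 uL _ (word_side_gt0 l0_gt0 s)).
Qed.

Let gfin : (\int[mu]_(x in Q0) (g x)%:E < +oo)%E.
Proof. by rewrite (gint [::]) ltry. Qed.

Let gintE s : wint g s = cube_grad u (word_corner a0 l0 s) (side s).
Proof. by rewrite /word_int gint. Qed.

(** Jensen's inequality for the perspective: integrate the tangent inequality with [c] the ratio of
    the two integrals, where the tangent is exact. *)
Let perspective_le s : perspective p (wint g s) (wint S s) <= wint H s.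
Proof.
have G0 : 0 <= wint g s by exact: word_int_ge0.
rewrite -perspective_tangent_eq //; set c := _ / _.
have c0 : 0 <= c by rewrite divr_ge0 // ltW.
have p0 : 0 <= p by rewrite (le_trans ler01) // ltW.
have p10 : 0 <= p - 1 by rewrite subr_ge0 ltW.
have k1 : 0 <= p * c `^ (p - 1) by rewrite mulr_ge0 // powR_ge0.
have k2 : 0 <= (p - 1) * c `^ p by rewrite mulr_ge0 // powR_ge0.
have mQ : measurable (Qs s : set LT) by exact: measurable_word_cube.
have sub : Qs s `<=` Q0 by exact: word_cube_sub.
have mQ0 : measurable Q0 by exact: (measurable_word_cube a0 l0 [::]).
have mgs := measurable_funS mQ0 sub mg.
have mSs := measurable_funS mQ0 sub mS.
have mHs := measurable_funS mQ0 sub mH.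
(* The negative term changes sides, so that only nonnegative functions are integrated. *)
suff : ((p * c `^ (p - 1) * wint g s)%:E <=
    (wint H s + (p - 1) * c `^ p * wint S s)%:E)%E.
  by rewrite lee_fin -lerBlDr !mulrA.
rewrite EFinD EFinM (EFinM ((p - 1) * _)).
rewrite (word_intE l0_gt0 g0 mg gfin) (word_intE l0_gt0 H0 mH Hfin).
rewrite (word_intE l0_gt0 S0 mS Sfin).
rewrite -(nneg_integralZl mu mQ mgs g0 k1) -(nneg_integralZl mu mQ mSs S0 k2).
have mkS : measurable_fun (Qs s : set LT) (fun x : LT => (p - 1) * c `^ p * S x).
  by apply: measurable_funM; [exact: measurable_cst|exact: mSs].
have kS0 x : 0 <= (p - 1) * c `^ p * S x by rewrite mulr_ge0.
rewrite -(nneg_integralD mu mQ mHs mkS H0 kS0).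
apply: (nneg_ae_le_integral mQ).
- by apply: measurable_funM; [exact: measurable_cst|exact: mgs].
- by apply: measurable_funD; [exact: mHs|exact: mkS].
- by move=> x; rewrite mulr_ge0.
- by move=> x; rewrite addr_ge0.
move: HS; apply: filterS => x Hx Qx.
have [Sx Hxe] := Hx (sub _ Qx).
rewrite Hxe -lerBlDr -!mulrA.
exact: perspective_tangent.
Qed.

Lemma weighted_poincare_cube :
  (\int[mu]_(x in Q0) (`|u x - l0 ^- n * cube_int u a0 l0| `^ q * W x)%:E <=
   (poincare_constant n p q K Cw Cs dw ds * wint H [::] `^ (q / p))%:E)%E.
Proof.
have q1 : 1 <= q := ltW (lt_le_trans p1 pq).
set D := poincare_constant _ _ _ _ _ _ _ _.
pose A := stop_factor q Cw Cs dw ds.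
have A1 : 1 <= A by rewrite le_max lexx.
have AW' : (Cw / (2 * 2 `^ q)^-1) `^ dw^-1 <= A by rewrite !le_max lexx orbT.
have AS' : (Cs / 2^-1) `^ ds^-1 <= A by rewrite !le_max lexx !orbT.
have th0 : 0 < 2 * 2 `^ q :> R by rewrite mulr_gt0 // powR_gt0.
have G0 s : 0 <= wint g s by exact: word_int_ge0.
have aG := word_int_additive l0_gt0 g0 mg gfin.
have V0 : 0 <= wint H [::] by exact: word_int_ge0.
have C0 : 0 <= carleson_constant p.
  rewrite divr_ge0 ?powR_ge0 // subr_ge0 ltW // -opprB powR_opp_lt1 ?subr_gt0 //.
  by lra.
have Hk k := @tree_inequality R B p q A (n%:R * 2 ^+ n) (K `^ (q / p))
  (2 * 2 `^ q)^-1 2^-1 side word_vol (wint W) (wint S) (wint g) (wint H)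
  (word_average u a0 l0) p1 pq A1 _ (powR_ge0 _ _) _ _
  (word_side_gt0 l0_gt0) _ (word_vol_gt0 (n := n) l0_gt0) Wgt0 Sgt0 G0
  (word_int_additive l0_gt0 W0 mW Wfin) (word_int_additive l0_gt0 S0 mS Sfin)
  aG (word_int_additive l0_gt0 H0 mH Hfin) perspective_le _ _ _ _ k.
have -> : D * wint H [::] `^ (q / p) = 2 `^ q *
   ((2 * (n%:R * 2 ^+ n) * A) `^ q *
    (2 `^ q * (2 * (K `^ (q / p) * (carleson_constant p * wint H [::]) `^ (q / p))))).
  by rewrite (powRM _ C0 V0) /D /poincare_constant -/A; ring.
apply: (integral_le_of_leaf_sums L0 uL l0_gt0 W0 mW Wfin q1) => k; apply: Hk => //.
- by rewrite mulfV // gt_eqF.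
- by rewrite mulfV // gt_eqF.
- move=> b s; rewrite gintE.
  exact: (average_subcube L0 uL (word_corner a0 l0 s) (word_side_gt0 l0_gt0 s) b).
- move=> j s Ps; apply: (stop_mass_principal_Ainfty l0_gt0 W0 mW Wfin Wgt0 Cw0 dw0 AW) => //.
- move=> j s Ps; apply: (stop_mass_principal_Ainfty l0_gt0 S0 mS Sfin Sgt0 Cs0 ds0 AS) => //.
- move=> s; apply: testing_powR => //; exact: word_side_gt0.
Qed.
End core.

(** * Comparison of the function with its Lipschitz extension *)

Section extension_facts.
Variables (R : realType) (n : nat) (f : 'rV[R]_n -> R) (L : R).
Hypotheses (L0 : 0 <= L) (fL : forall x y, `|f x - f y| <= L * `|x - y|).
Variables (a : 'rV[R]_n) (l : R) (u : 'rV[R]_n -> R).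
Hypotheses (l0 : 0 < l) (fu : forall x, cube a l x -> f x = u x).
Local Notation mu := (lebesgue_rV R n).
Local Notation LT := (lebesgue_type R n).

Lemma average_extension : average u (cube a l) = l ^- n * cube_int f a l.
Proof.
have mQ : measurable (cube a l) by exact: measurable_cube.
rewrite /average lebesgue_rV_cube //; congr (_ * _).
have -> : \int[mu]_(x in cube a l) u x = \int[mu]_(x in cube a l) f x.
  by apply: eq_Rintegral => x; rewrite inE => Qx; rewrite fu.
apply: Rintegral_lebesgue_rV => //; first exact: lipschitz_measurable L0 fL.
apply: measurable_bounded_integrable.
- exact: borel_lebesgue_measurable.
- by rewrite lebesgue_rV_cube // ltry.
- by apply: measurable_fun_completion; exact: lipschitz_measurable L0 fL.
- exists (`|f 0| + L * (`|a| + l)); split; first exact: num_real.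
  move=> D CD x Qx /=; apply: le_trans (ltW CD).
  rewrite -[f _](subrK (f 0)) addrC (le_trans (ler_normD _ _)) // lerD //.
  rewrite (le_trans (fL _ _)) // subr0 ler_wpM2l //.
  exact: cube_norm_le Qx.
Qed.

(** At an interior point the two functions have the same difference quotients for small increments,
    so the limits, which exist for [f], coincide. *)
Lemma gradient_extension x : cube a l x -> (forall i, a ord0 i < x ord0 i) ->
  (forall i, derivable_set f i x) -> enorm (gradient u x) = partial_norm f x.
Proof.
move=> Qx ax Dx; congr enorm; apply/rowP => i; rewrite !mxE.
rewrite /partial patchE mem_set //.
apply: cvg_lim; first exact: Rhausdorff.
have H : h^-1 *: ((f \o shift x) (h *: delta_mx ord0 i) - f x) @[h --> (0 : R)^']
   --> 'D_(delta_mx ord0 i) f x by exact: Dx.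
apply: cvg_trans H; apply: near_eq_cvg.
have /andP[_ xi] := Qx i.
have d1 : 0 < x ord0 i - a ord0 i by rewrite subr_gt0.
have d2 : 0 < a ord0 i + l - x ord0 i by rewrite subr_gt0.
near=> h.
have h1 : `|h| < x ord0 i - a ord0 i by near: h; exact: dnbhs0_lt.
have h2 : `|h| < a ord0 i + l - x ord0 i by near: h; exact: dnbhs0_lt.
rewrite /= (fu Qx) fu // => j; rewrite !mxE eqxx /=.
have [->|ji] := eqVneq j i; last by rewrite mulr0 add0r; exact: Qx.
move: h1 h2; rewrite !ltr_norml => /andP[a1 a2] /andP[b1 b2].
by rewrite mulr1; apply/andP; split; lra.
Unshelve. all: by end_near. Qed.

Lemma gradient_extension_ae : mu.-negligible
  [set x | cube a l x /\ enorm (gradient u x) <> partial_norm f x].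
Proof.
pose N (k : nat) := if insub k is Some i then ~` derivable_set f i else set0.
have negN : mu.-negligible (\bigcup_k N k).
  apply: negligible_bigcup => k; rewrite /N; case: insubP => [i _ _|_].
    have mD : measurable (~` derivable_set f i).
      by apply: measurableC; exact: measurable_derivable_set L0 fL i.
    exists (~` derivable_set f i); split => //.
      exact: borel_lebesgue_measurable.
    by rewrite lebesgue_rVE //; exact: derivable_set_null L0 fL i.
  exact: negligible_set0.
apply: negligibleS (negligibleU (cube_boundary_negligible a l0) negN).
move=> x [Qx gx]; apply: contrapT => /not_orP[b Nx]; apply: gx.
apply: gradient_extension => // i.
  by apply/negPn/negP => xi; apply: b; split => // H; move: xi; rewrite H.
by apply: contrapT => Di; apply: Nx; exists i => //; rewrite /N valK.
Qed.
End extension_facts.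

Lemma poincare_constant_gt0 (R : realType) (n : nat) (p q K Cw Cs dw ds : R) :
  (0 < n)%N -> 1 < p -> 0 < K -> 0 < poincare_constant n p q K Cw Cs dw ds.
Proof.
move=> n0 p1 K0; rewrite /poincare_constant.
have A0 : 0 < stop_factor q Cw Cs dw ds by rewrite lt_max ltr01.
have c0 : 0 < carleson_constant p.
  by rewrite divr_gt0 ?powR_gt0 // subr_gt0 -opprB powR_opp_lt1 ?subr_gt0 //; lra.
have t0 : 0 < (2 : R) `^ q by rewrite powR_gt0.
have n0' : 0 < (n%:R : R) by rewrite ltr0n.
have n2 : 0 < n%:R * 2 ^+ n :> R by rewrite mulr_gt0 // exprn_gt0.
have e1 : 0 < (2 * (n%:R * 2 ^+ n) * stop_factor q Cw Cs dw ds) `^ q.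
  by rewrite powR_gt0 // mulr_gt0 // mulr_gt0.
have e2 : 0 < K `^ (q / p) * carleson_constant p `^ (q / p).
  by rewrite mulr_gt0 // powR_gt0.
apply: mulr_gt0 => //; apply: mulr_gt0 => //; apply: mulr_gt0 => //.
exact: mulr_gt0.
Qed.

Unset Implicit Arguments.
Set Strict Implicit.
Set Printing Implicit Defensive.

Theorem theorem5p4 (R : realType) (n : nat) (p q K Cw Csigma dw dsigma : R)
    (hn : (0 < n)%N) (hp : 1 < p) (hpq : p <= q) (hK : 0 < K) :
  exists C : R, 0 < C /\
    forall (Q0 : set 'rV[R]_n) (v w : 'rV[R]_n -> R),
      let sigma := fun x => v x `^ (- (p - 1)^-1) in
      is_cube Q0 -> weight Q0 v -> weight Q0 w ->
      dyadic_Ainfty Q0 w Cw dw ->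
      dyadic_Ainfty Q0 sigma Csigma dsigma ->
      (forall Q, dyadic Q0 Q ->
        ((lebesgue_rV R n Q `^ (1 - n%:R^-1))^-1 `^ p *
          wmeas w Q `^ (p / q) * wmeas sigma Q `^ (p - 1) <= K%:E)%E) ->
      forall u : 'rV[R]_n -> R, [lipschitz u x | x in Q0] ->
        ((\int[lebesgue_rV R n]_(x in Q0)
            (`|u x - average u Q0| `^ q * w x)%:E) `^ q^-1
         <= C%:E * (\int[lebesgue_rV R n]_(x in Q0)
            (enorm (gradient u x) `^ p * v x)%:E) `^ p^-1)%E.
Proof.
have D0 := poincare_constant_gt0 q Cw Csigma dw dsigma hn hp hK.
set D := poincare_constant _ _ _ _ _ _ _ _ in D0.
have p0 : 0 < p by lra.
have q0 : 0 < q by lra.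
exists (D `^ q^-1); split; first by rewrite powR_gt0.
move=> _ v w sigma [a [l [l0 ->]]] [mv _ vpos] [mw _ wpos].
move=> [_ Cw0 dw0 Aw] [[ms _ _] Cs0 ds0 As] test u uLip.
set mu := lebesgue_rV R n.
have aQ : cube a l !=set0.
  by exists a => i; rewrite lexx ltrDl.
have [L [f [L0 fL fu]]] := lipschitz_extension uLip aQ.
have mQ : measurable (cube a l : set (lebesgue_type R n)).
  exact: (measurable_word_cube a l [::]).
(* [v] and [w] are positive only almost everywhere; absolute values make them nonnegative everywhere
   without changing the integrals. *)
pose W x := `|w x|; pose g := partial_norm f.
pose H x := g x `^ p * `|v x|.
have mW : measurable_fun (cube a l : set (lebesgue_type R n))
    (W : lebesgue_type R n -> R) by exact: measurable_fun_norm.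
have mg : measurable_fun (cube a l : set (lebesgue_type R n))
    (fun x : lebesgue_type R n => g x `^ p).
  apply: (@measurable_fun_completion R n _ _ (fun x => g x `^ p)).
  apply: (@measurableT_comp _ _ _ _ _ _ (fun t : R => t `^ p)).
    exact: measurable_powR.
  exact: measurable_partial_norm L0 fL.
have mH : measurable_fun (cube a l : set (lebesgue_type R n))
    (H : lebesgue_type R n -> R).
  by apply: measurable_funM; [exact: mg|exact: measurable_fun_norm].
have W0 x : 0 <= W x by exact: normr_ge0.
have S0 x : 0 <= sigma x by exact: powR_ge0.
have H0 x : 0 <= H x by rewrite mulr_ge0 // powR_ge0.
have wW (E : set (lebesgue_type R n)) : measurable E -> E `<=` cube a l ->
    wmeas w E = (\int[mu]_(x in E) (W x)%:E)%E.
  move=> mE EQ; apply: (ae_eq_integral_EFin mE).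
  - exact: (measurable_funS mQ EQ mw).
  - exact: (measurable_funS mQ EQ mW).
  apply: (@filterS _ _ (ae_filter_ringOfSetsType mu) _ _ _ wpos) => x wx Ex.
  by rewrite /W gtr0_norm // wx //; exact: EQ.
have word_sub s : word_cube a l s `<=` cube a l by exact: word_cube_sub.
have wWs s := wW _ (measurable_word_cube a l s) (@word_sub s).
have Wfin : (\int[mu]_(x in cube a l) (W x)%:E < +oo)%E.
  by rewrite -wW //; have [/andP[]] := Aw _ (dyadic_root _).
have Sfin : (\int[mu]_(x in cube a l) (sigma x)%:E < +oo)%E.
  by have [/andP[]] := As _ (dyadic_root _).
have Wgt0 s : 0 < word_int a l W s.
  rewrite -lte_fin word_intE // -wWs.
  by have [/andP[]] := Aw _ (dyadic_word_cube a l0 s).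
have Sgt0 s : 0 < word_int a l sigma s.
  rewrite -lte_fin word_intE //.
  by have [/andP[]] := As _ (dyadic_word_cube a l0 s).
have -> : (\int[mu]_(x in cube a l) (enorm (gradient u x) `^ p * v x)%:E =
    \int[mu]_(x in cube a l) (H x)%:E)%E.
  have [Nv [mNv Nv0 NvP]] := vpos.
  have negN : mu.-negligible (Nv `|` [set x | cube a l x /\
      enorm (gradient u x) <> partial_norm f x]).
    apply: negligibleU; first by exists Nv; split.
    exact (gradient_extension_ae L0 fL l0 fu).
  have EN x : cube a l x -> ~ (Nv `|` [set x | cube a l x /\
      enorm (gradient u x) <> partial_norm f x]) x ->
      enorm (gradient u x) `^ p * v x = H x.
    move=> Qx /not_orP[nv ng].
    have vx : 0 < v x.
      by apply: contrapT => vx; apply: nv; apply: NvP => /(_ Qx).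
    have gx : enorm (gradient u x) = partial_norm f x.
      by apply: contrapT => gx; apply: ng.
    by rewrite gx /H gtr0_norm.
  apply: (ae_eq_integral_EFin mQ _ mH).
    (* The integrand with [gradient u] inherits measurability from [H]. *)
    exact: (measurable_fun_ae_eq mQ mH negN EN).
  have [N [mN N0 NP]] := negN; exists N; split => // x /= Hx; apply: NP.
  by apply: contrapT => Nx; apply: Hx => Qx; rewrite EN.
have -> : (\int[mu]_(x in cube a l) (`|u x - average u (cube a l)| `^ q * w x)%:E =
    \int[mu]_(x in cube a l) (`|f x - l ^- n * cube_int f a l| `^ q * W x)%:E)%E.
  rewrite (average_extension L0 fL l0 fu).
  transitivity (\int[mu]_(x in cube a l)
      (`|f x - l ^- n * cube_int f a l| `^ q * w x)%:E)%E.
    by apply: eq_integral => x; rewrite inE => Qx; rewrite fu.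
  have mf : measurable_fun (cube a l : set (lebesgue_type R n))
      (fun x : lebesgue_type R n => `|f x - l ^- n * cube_int f a l| `^ q).
    apply: (@measurable_fun_completion R n _ _
      (fun x => `|f x - l ^- n * cube_int f a l| `^ q)).
    apply: (@measurableT_comp _ _ _ _ _ _ (fun t : R => t `^ q)).
      exact: measurable_powR.
    apply: measurableT_comp => //; apply: measurable_funB => //.
    exact: lipschitz_measurable L0 fL.
  apply: (ae_eq_integral_EFin mQ).
  - exact: (measurable_funM mf mw).
  - exact: (measurable_funM mf mW).
  apply: (@filterS _ _ (ae_filter_ringOfSetsType mu) _ _ _ wpos) => x wx Qx.
  congr (_ * _).
  by rewrite /W gtr0_norm // wx.
(* If the right-hand integral is infinite, so is its product with the positive constant, and the
   claim is trivial. *)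
have [Hfin|] := ltP (\int[mu]_(x in cube a l) (H x)%:E)%E +oo%E; last first.
  rewrite leye_eq => /eqP ->; rewrite poweRyr ?gt_eqF ?invr_gt0 //.
  by rewrite mulry gtr0_sg ?powR_gt0 // mul1e leey.
have HS : {ae mu, forall x, cube a l x ->
    0 < sigma x /\ H x = perspective p (partial_norm f x) (sigma x)}.
  apply: (@filterS _ _ (ae_filter_ringOfSetsType mu) _ _ _ vpos) => x vx Qx.
  have v0 := vx Qx.
  split; first exact: powR_gt0.
  (* The exponents -1/(p-1) and 1-p have product 1, so sigma^(1-p) is v. *)
  rewrite /H /perspective gtr0_norm // /sigma -powRrM; congr (_ * _).
  rewrite (_ : - (p - 1)^-1 * (1 - p) = 1) ?powRr1 ?(ltW v0) //.
  by field; rewrite subr_eq0 gt_eqF.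
have test' s : ((word_side l s ^+ n) `^ (1 - n%:R^-1))^-1 `^ p *
    word_int a l W s `^ (p / q) * word_int a l sigma s `^ (p - 1) <= K.
  have := test _ (dyadic_word_cube a l0 s).
  rewrite lebesgue_word_cube // wWs -word_intE // /wmeas -word_intE //.
  by rewrite !poweR_EFin inver gt_eqF ?powR_gt0 ?exprn_gt0 ?word_side_gt0.
have AW s (E : set (lebesgue_type R n)) : measurable E ->
    E `<=` word_cube a l s ->
    (\int[mu]_(x in E) (W x)%:E / \int[mu]_(x in word_cube a l s) (W x)%:E <=
     Cw%:E * (mu E / mu (word_cube a l s)) `^ dw)%E.
  move=> mE EQ; have [_ H1] := Aw _ (dyadic_word_cube a l0 s).
  rewrite -wWs -wW //; last exact: subset_trans EQ (@word_sub s).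
  exact: H1.
have AS s (E : set (lebesgue_type R n)) : measurable E ->
    E `<=` word_cube a l s ->
    (\int[mu]_(x in E) (sigma x)%:E /
       \int[mu]_(x in word_cube a l s) (sigma x)%:E <=
     Csigma%:E * (mu E / mu (word_cube a l s)) `^ dsigma)%E.
  by move=> mE EQ; have [_ H1] := As _ (dyadic_word_cube a l0 s); exact: H1.
have main := @weighted_poincare_cube R n p q K Cw Csigma dw dsigma hn hp hpq
  Cw0 Cs0 dw0 ds0 f L L0 fL a l l0 W sigma H W0 S0 H0 mW ms mH Wfin Sfin Hfin
  Wgt0 Sgt0 AW AS test' HS.
have HE : (\int[mu]_(x in cube a l) (H x)%:E = (word_int a l H [::])%:E)%E.
  by rewrite word_intE.
have V0 : 0 <= word_int a l H [::] by exact: word_int_ge0.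
rewrite HE poweR_EFin -EFinM.
rewrite (_ : D `^ q^-1 * _ = (D * word_int a l H [::] `^ (q / p)) `^ q^-1); last first.
  rewrite powRM ?powR_ge0 ?(ltW D0) // -powRrM; congr (_ * _ `^ _).
  by field; rewrite !gt_eqF.
rewrite -poweR_EFin; apply: gt0_ler_poweR main.
- by rewrite invr_ge0 ltW.
- rewrite in_itv /= leey andbT; apply: integral_ge0 => x _.
  by rewrite lee_fin mulr_ge0 // powR_ge0.
- by rewrite in_itv /= leey andbT lee_fin mulr_ge0 ?powR_ge0 // ltW.
Qed.
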